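(* Let $K_G$ be the real Grothendieck constant and let $c=1.676956674215576237077855078853\ldots$ be the Davie--Reeds constant. Then $$K_G\ \ge\ c+10^{-26}.$$
   Context: $K_G$ is the infimum of all $K\in(0,\infty)$ such that for all positive integers $m,n$ and every real $m\times n$ matrix $(a_{ij})$, $$\max_{x_1,\ldots,x_m,y_1,\ldots,y_n\in S^{m+n-1}}\sum_{i=1}^m\sum_{j=1}^n a_{ij}\langle x_i,y_j\rangle\le K\max_{\epsilon_1,\ldots,\epsilon_m,\delta_1,\ldots,\delta_n\in\{-1,1\}}\sum_{i=1}^m\sum_{j=1}^n a_{ij}\epsilon_i\delta_j,$$ where $S^{d-1}$ is the Euclidean unit sphere of $\mathbb{R}^d$ and $\langle\cdot,\cdot\rangle$ the standard inner product. The constant $c$: with $\Phi(t)=\int_{-\infty}^t e^{-z^2/2}\,dz/\sqrt{2\pi}$ and, for $\eta\in(0,1)$, $\lambda(\eta)=\sqrt{2/\pi}\,\eta e^{-\eta^2/2}$, $$c=\max_{\eta\in(0,1)}\frac{1-\lambda(\eta)}{(\lambda(\eta)/\eta)^2+\lambda(\eta)\,(1-4\Phi(-\eta))}=1.676956674215576237077855078853\ldots,$$ the maximum being attained where $\lambda(\eta)=\lambda_*\approx 0.1974790909949819604$. *)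

(* Defs.v *)
From mathcomp Require Import all_boot all_order all_algebra.
From mathcomp Require Import all_classical all_reals all_analysis.

Set Implicit Arguments.
Unset Strict Implicit.
Unset Printing Implicit Defensive.

Import Order.TTheory GRing.Theory Num.Theory.
Import numFieldNormedType.Exports.

Local Open Scope classical_set_scope.
Local Open Scope ring_scope.

(* The library norm `|u| on 'rV[R]_d is the sup norm, so the Euclidean
   structure is spelled out. *)
Definition dotprod (R : realType) (d : nat) (u v : 'rV[R]_d) : R :=
  \sum_(k < d) u ord0 k * v ord0 k.

Definition euclidean_norm (R : realType) (d : nat) (u : 'rV[R]_d) : R :=
  Num.sqrt (dotprod u u).

(* S^(d-1) *)
Definition unit_sphere (R : realType) (d : nat) : set 'rV[R]_d :=
  [set u | euclidean_norm u = 1].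

Definition signs (R : realType) : set R := [set 1; -1].

(* For m, n > 0 the two suprema below are over nonempty compact sets of values
   (a continuous image of a product of spheres, and a finite set), hence they
   are maxima. *)
Definition max_spheres (R : realType) (m n : nat) (a : 'M[R]_(m, n)) : R :=
  sup [set \sum_(i < m) \sum_(j < n) a i j * dotprod (x i) (y j) |
         x in [set x : 'I_m -> 'rV[R]_(m + n) |
                forall i, unit_sphere (x i)] &
         y in [set y : 'I_n -> 'rV[R]_(m + n) |
                forall j, unit_sphere (y j)]].

Definition max_signs (R : realType) (m n : nat) (a : 'M[R]_(m, n)) : R :=
  sup [set \sum_(i < m) \sum_(j < n) a i j * eps i * delta j |
         eps in [set eps : 'I_m -> R | forall i, signs (eps i)] &
         delta in [set delta : 'I_n -> R | forall j, signs (delta j)]].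

Definition grothendieck_bound (R : realType) (K : R) : Prop :=
  forall m n : nat, (0 < m)%N -> (0 < n)%N ->
  forall a : 'M[R]_(m, n), max_spheres a <= K * max_signs a.

(* The infimum is taken in the extended reals, where inf set0 = +oo; the real
   inf would return the junk value 0 on the empty set. *)
Definition grothendieck_constant (R : realType) : \bar R :=
  ereal_inf [set K%:E | K in [set K : R | 0 < K /\ grothendieck_bound K]].

Definition Phi (R : realType) (t : R) : R :=
  \int[lebesgue_measure]_(z in `]-oo, t])
    (expR (- (z ^+ 2 / 2)) / Num.sqrt (2 * pi)).

Definition lambda (R : realType) (eta : R) : R :=
  Num.sqrt (2 / pi) * eta * expR (- (eta ^+ 2 / 2)).

Definition davie_reeds_fun (R : realType) (eta : R) : R :=
  (1 - lambda eta) /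
  ((lambda eta / eta) ^+ 2 + lambda eta * (1 - 4 * Phi (- eta))).

(* This supremum is attained, at the eta ~ 0.25573 with
   lambda eta = 0.19747909..., where it is 1.67695667421557... *)
Definition davie_reeds_constant (R : realType) : R :=
  sup [set davie_reeds_fun eta | eta in `]0, 1[ : set R].

(* Main.v *)
(* Let [phi], [Phi] be the Gaussian density and distribution function.  At the
   optimal [eta] one has [4 phi(eta)^2 = 4 Phi(- eta) - 1 =: alpha] and
   [c = 1 / alpha].  With [P1] the projection onto the linear functions of a
   Gaussian vector, the Davie-Reeds operator [P1 - lambda I] has value [1 - lambda]
   on the vectors [x / |x|], and at most [alpha (1 - lambda)] on signs.

   Perturb it by [- e (T - sg P1)], where [T] is a noise operator of small noise
   [1 - sg].  The value on [x / |x|] is unchanged, because [T] acts on linear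
   functions as [sg].  For signs [f], [g] put [s = (f + g) / 2], [d = (f - g) / 2], so
   that [|d| = 1 - |s|].  As [T] is positive, [<d, T d> <= <|d|, T |d|>], and then
     [- <s, T s> + <d, T d> <= 1 - 2 E|s| + 2 P(s(x) s(y) = -1)]
   where [y] is a noisy copy of [x].  Near the optimum [s] is the sign of a linear
   form [L] where [|L| > eta] and 0 elsewhere, so [s(x) s(y) = -1] forces
   [|L(x) - L(y)| > eta], an event of probability [O((1 - sg)^2)], and the value on
   signs drops by [e alpha (1 - sg)] up to lower order terms.

   Everything is carried out on a discrete cube: a Gaussian coordinate is replaced
   by a normalized sum of [B * M] signs, and [T] flips the signs of one of [B] blocks
   chosen at random. *)

Require Import Defs.
From HB Require Import structures.
From mathcomp Require Import all_boot all_order all_algebra.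
From mathcomp Require Import all_classical all_reals all_analysis.
From mathcomp Require Import ring lra.

Set Implicit Arguments.
Unset Strict Implicit.
Unset Printing Implicit Defensive.

Import Order.TTheory GRing.Theory Num.Theory.
Import numFieldNormedType.Exports.

Local Open Scope classical_set_scope.
Local Open Scope ring_scope.

(** * The Gaussian distribution function *)

Lemma mean_value_in (R : realType) (f df : R -> R) (a b : R) : a <= b ->
  (forall x : R, a <= x <= b -> is_derive x 1 f (df x)) ->
  exists2 c, a <= c <= b & f b - f a = df c * (b - a).
Proof.
move=> ab fdf.
have cf : {within `[a, b], continuous f}.
  apply: derivable_within_continuous => x; rewrite in_itv /= => /fdf.
  by case.
have fdf' x : x \in `]a, b[ -> is_derive x 1 f (df x).
  by rewrite in_itv /= => /andP[ax xb]; apply: fdf; rewrite !ltW.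
have [c + ->] := MVT_segment ab fdf' cf.
by rewrite in_itv /=; exists c.
Qed.

Lemma mean_value (R : realType) (f df : R -> R) :
  (forall x : R, is_derive x 1 f (df x)) -> forall a b, a <= b ->
  exists2 c, a <= c <= b & f b - f a = df c * (b - a).
Proof. by move=> fdf a b ab; apply: mean_value_in => // x _; exact: fdf. Qed.

Lemma derive_ge0_le (R : realType) (f df : R -> R) (a b : R) :
  (forall x : R, is_derive x 1 f (df x)) -> a <= b ->
  (forall x, a <= x <= b -> 0 <= df x) -> f a <= f b.
Proof.
move=> fdf ab df0; have [c cab E] := mean_value fdf ab.
by rewrite -subr_ge0 E mulr_ge0 ?subr_ge0 ?df0.
Qed.

Definition gauss (R : realType) (x : R) : R :=
  expR (- (x ^+ 2 / 2)) / Num.sqrt (2 * pi).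

Lemma gauss_gt0 (R : realType) (x : R) : 0 < gauss x.
Proof. by rewrite divr_gt0 ?expR_gt0// sqrtr_gt0 mulr_gt0 ?pi_gt0. Qed.

Lemma gaussN (R : realType) (x : R) : gauss (- x) = gauss x.
Proof. by rewrite /gauss sqrrN. Qed.

Lemma is_derive_gauss (R : realType) (x : R) :
  is_derive x 1 (@gauss R) (- x * gauss x).
Proof.
rewrite /gauss.
have d1 : is_derive x 1 (fun y : R => - (y ^+ 2 / 2)) (- x).
  apply: is_derive_eq.
  by rewrite /GRing.scale /=; field.
have d2 := @is_derive1_comp R expR _ x _ _ (is_derive_expR _) d1.
apply: is_derive_eq.
by rewrite /GRing.scale /=; ring.
Qed.
#[global] Existing Instance is_derive_gauss.

Lemma gauss_le0 (R : realType) (x : R) : gauss x <= gauss 0.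
Proof.
rewrite ler_pM2r ?invr_gt0 ?sqrtr_gt0 ?mulr_gt0 ?pi_gt0// ler_expR.
by rewrite expr0n /= mul0r oppr0 oppr_le0 divr_ge0 ?sqr_ge0.
Qed.

Lemma gauss0_le (R : realType) : gauss 0 <= 1 / 2 :> R.
Proof.
rewrite /gauss expr0n /= mul0r oppr0 expR0 ler_pM2l// lef_pV2 ?posrE//; last first.
  by rewrite sqrtr_gt0 mulr_gt0 ?pi_gt0.
have e : Num.sqrt (2 ^+ 2) = 2 :> R by rewrite sqrtr_sqr ger0_norm.
rewrite -[leLHS]e.
by rewrite ler_sqrt// ?mulr_ge0 ?pi_ge0// expr2 ler_pM2l// pi_ge2.
Qed.

(** The derivative [- x * gauss x] is at most 1 in absolute value, because [|x| <= 1 + x ^+ 2 / 2 <=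
    expR (x ^+ 2 / 2)] and the normalizing factor is below 1. *)
Lemma gauss_lipschitz (R : realType) (x y : R) : `|gauss x - gauss y| <= `|x - y|.
Proof.
wlog yx : x y / y <= x.
  by move=> H; case: (leP y x) => [/H//|/ltW/H]; rewrite distrC (distrC y).
have [c _ ->] := mean_value (@is_derive_gauss R) yx.
rewrite normrM ler_piMl// normrM normrN (ger0_norm (ltW (gauss_gt0 c))).
have e1 : `|c| * expR (- (c ^+ 2 / 2)) <= 1.
  rewrite expRN ler_pdivrMr ?expR_gt0// mul1r.
  apply: le_trans (expR_ge1Dx _).
  rewrite -(real_normK (num_real c)).
  have : 0 <= (`|c| - 1) ^+ 2 by exact: sqr_ge0.
  nra.
rewrite /gauss mulrA mulr_ile1 ?mulr_ge0 ?invr_ge0 ?expR_ge0 ?sqrtr_ge0//.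
by have := gauss0_le R; rewrite /gauss expr0n /= mul0r oppr0 expR0 mul1r; lra.
Qed.

Lemma gauss_normal_pdf (R : realType) : @gauss R = normal_pdf 0 1.
Proof.
apply/funext => x; rewrite normal_pdfE ?oner_eq0// /normal_peak /normal_fun /gauss.
by rewrite mulrC subr0 expr1n mul1r mulNr mulr_natl.
Qed.

Lemma continuous_gauss (R : realType) : continuous (@gauss R).
Proof. by rewrite gauss_normal_pdf; apply: continuous_normal_pdf; exact: oner_neq0. Qed.

Lemma integrable_gauss (R : realType) (D : set R) : measurable D ->
  (@lebesgue_measure R).-integrable D (EFin \o @gauss R).
Proof.
move=> mD; rewrite gauss_normal_pdf.
by apply: integrableS (integrable_normal_pdf _ _) => //; exact: measurableT.
Qed.

Lemma is_derive_Phi (R : realType) (x : R) : is_derive x 1 (@Phi R) (gauss x).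
Proof.
have [||||d <-] := @continuous_FTC1 R (@gauss R) -oo%O x (x + 1).
- by rewrite ltrDl.
- exact: integrable_gauss.
- by rewrite ltNyr.
- exact: continuous_gauss.
by rewrite derive1E; apply: derivableP.
Qed.
#[global] Existing Instance is_derive_Phi.

Lemma Phi_normal_cdf (R : realType) (x : R) :
  (Phi x)%:E = normal_prob 0 1 `]-oo, x].
Proof.
rewrite /Phi /normal_prob -gauss_normal_pdf fineK//.
by apply: integrable_fin_num => //; exact: integrable_gauss.
Qed.

(** The identity as a random variable under the standard normal law: [Phi] is its distribution
    function, so the general facts on [cdf] give its limits and monotonicity. *)
Definition real_id (R : realType) : measurableTypeR R -> R := idfun.

HB.instance Definition _ (R : realType) :=
  @isMeasurableFun.Build _ _ _ _ (@real_id R) (@measurable_id _ _ setT).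

Lemma Phi_cdf (R : realType) (x : R) :
  (Phi x)%:E = cdf (@real_id R : {RV (normal_prob 0 1) >-> R}) x.
Proof. exact: Phi_normal_cdf. Qed.

Lemma Phi_cvgNy (R : realType) : @Phi R x @[x --> -oo] --> (0 : R).
Proof.
have /fine_cvg : (@Phi R x)%:E @[x --> -oo] --> 0%:E ; last by [].
under eq_fun do rewrite Phi_cdf.
exact: cvg_cdfNy0.
Qed.

Lemma Phi_cvgy (R : realType) : @Phi R x @[x --> +oo] --> (1 : R).
Proof.
have /fine_cvg : (@Phi R x)%:E @[x --> +oo] --> 1%:E ; last by [].
under eq_fun do rewrite Phi_cdf.
exact: cvg_cdfy1.
Qed.

Lemma Phi_ge0 (R : realType) (x : R) : 0 <= Phi x.
Proof. by rewrite -lee_fin Phi_cdf cdf_ge0. Qed.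

Lemma Phi_ndecr (R : realType) (x y : R) : x <= y -> Phi x <= Phi y.
Proof. by move=> xy; rewrite -lee_fin !Phi_cdf cdf_nondecreasing. Qed.

(** The sum [Phi (- y) + Phi y] has zero derivative, the density being even, and tends to 1 at
    +oo. *)
Lemma PhiN (R : realType) (x : R) : Phi (- x) = 1 - Phi x.
Proof.
pose f (y : R) := Phi (- y) + Phi y.
have fd (y : R) : is_derive y 1 f 0.
  have d1 := @is_derive1_comp R (@Phi R) -%R y _ _ (is_derive_Phi _) (is_deriveNid _ _).
  by apply: is_derive_eq; rewrite gaussN; ring.
have fc (y : R) : f y = f 0.
  case: (leP 0 y) => [y0|/ltW y0]; have [c _ E] := mean_value fd y0; lra.
have f1 : f y @[y --> +oo] --> (1 : R).
  rewrite -[1]add0r; apply: cvgD; last exact: Phi_cvgy.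
  by have := @Phi_cvgNy R; rewrite cvgNy_compNP.
have f2 : f y @[y --> +oo] --> f 0.
  by rewrite (_ : f = cst (f 0)); [exact: cvg_cst|apply/funext => y; exact: fc].
have e : f 0 = 1 by apply: cvg_unique f2 f1.
by rewrite -e -(fc x) /f; ring.
Qed.

Lemma Phi0 (R : realType) : Phi 0 = 1 / 2 :> R.
Proof. have := @PhiN R 0; rewrite oppr0; lra. Qed.

Lemma Phi_lipschitz (R : realType) (x y : R) : x <= y ->
  Phi y - Phi x <= gauss 0 * (y - x).
Proof.
move=> xy; have [c _ ->] := mean_value (@is_derive_Phi R) xy.
by rewrite ler_wpM2r ?subr_ge0// gauss_le0.
Qed.

(* [pos_mean y] is the mean of [max 0 (y + g)] for a standard Gaussian [g]. *)
Definition pos_mean (R : realType) (y : R) : R := y * Phi y + gauss y.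

Lemma is_derive_pos_mean (R : realType) (y : R) : is_derive y 1 (@pos_mean R) (Phi y).
Proof.
rewrite /pos_mean; apply: is_derive_eq.
by rewrite /GRing.scale /=; ring.
Qed.
#[global] Existing Instance is_derive_pos_mean.

Lemma pos_meanN (R : realType) (y : R) : pos_mean (- y) = pos_mean y - y.
Proof. by rewrite /pos_mean PhiN gaussN; ring. Qed.

(* Mills' inequality: [Phi z + gauss z / z] has a negative derivative for [z < 0]
   and tends to 0 at -oo. *)
Lemma pos_mean_ge0 (R : realType) (y : R) : 0 <= pos_mean y.
Proof.
case: (ltP y 0) => [y0|y0]; last first.
  by apply: addr_ge0; [apply: mulr_ge0 => //; exact: Phi_ge0|exact/ltW/gauss_gt0].
pose f (z : R) := Phi z + gauss z * z^-1.
have fy (z : R) : z <= y -> f y <= Phi z.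
  move=> zy; have fd (x : R) : z <= x <= y ->
      is_derive x 1 f (- (gauss x * x^-1 ^+ 2)).
    move=> /andP[_ xy]; have x0 : x != 0 by rewrite lt_eqF ?(le_lt_trans xy).
    have dV : is_derive x 1 (fun t : R => t^-1) (- x^-1 ^+ 2).
      have di : derivable (id : R -> R) x 1 by exact: derivable_id.
      apply: DeriveDef; first exact: (@derivableV _ _ id).
      rewrite (@deriveV _ _ id) ?derive_id//.
      by rewrite /GRing.scale /= mulr1 exprVn.
    apply: is_derive_eq; rewrite /GRing.scale /=.
    by field.
  have [c _ E] := mean_value_in zy fd.
  have g0 := gauss_gt0 z; have g1 := gauss_gt0 c.
  have : 0 <= gauss c * c^-1 ^+ 2 * (y - z).
    by rewrite mulr_ge0 ?subr_ge0// mulr_ge0 ?sqr_ge0// ltW.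
  have : 0 <= gauss z * (- z^-1).
    by apply: mulr_ge0; [exact: ltW|rewrite oppr_ge0 invr_le0; lra].
  rewrite /f in E *; lra.
have : f y <= 0.
  apply: cvgr_to_ge (@Phi_cvgNy R) _.
  by apply: filterS (nbhs_ninfty_le (num_real y)) => z; exact: fy.
rewrite /f /pos_mean => H.
have : 0 <= y * (Phi y + gauss y * y^-1) by apply: mulr_le0 => //; exact: ltW.
by rewrite mulrDr mulrCA divff ?mulr1 // lt_eqF.
Qed.

Lemma pos_mean_ge (R : realType) (y : R) : y <= pos_mean y.
Proof. by rewrite -subr_ge0 -pos_meanN pos_mean_ge0. Qed.

Lemma pos_mean_tangent (R : realType) (x z : R) : pos_mean z + Phi z * (x - z) <= pos_mean x.
Proof.
case: (leP z x) => [zx|/ltW xz].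
  have [c /andP[zc _] E] := mean_value (@is_derive_pos_mean R) zx.
  have := ler_wpM2r (_ : 0 <= x - z) (Phi_ndecr zc); rewrite subr_ge0 => /(_ zx); lra.
have [c /andP[_ cz] E] := mean_value (@is_derive_pos_mean R) xz.
have := ler_wpM2r (_ : 0 <= z - x) (Phi_ndecr cz); rewrite subr_ge0 => /(_ xz); lra.
Qed.

(** The second derivative of [pos_mean] is [gauss], whose maximum is [gauss 0]. This controls the
    mean excess over a threshold close to the optimal one. *)
Lemma pos_mean_quadratic (R : realType) (x z : R) :
  pos_mean x <= pos_mean z + Phi z * (x - z) + gauss 0 / 2 * (x - z) ^+ 2.
Proof.
pose f (y : R) := pos_mean z + Phi z * (y - z) + gauss 0 / 2 * (y - z) ^+ 2 - pos_mean y.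
have fd (y : R) : is_derive y 1 f (Phi z + gauss 0 * (y - z) - Phi y).
  by apply: is_derive_eq; rewrite /GRing.scale /=; field.
have fz : f z = 0 by rewrite /f; ring.
rewrite -subr_ge0 -/(f x).
case: (leP z x) => [zx|/ltW xz].
  have [c /andP[zc _] E] := mean_value fd zx.
  have : 0 <= (Phi z + gauss 0 * (c - z) - Phi c) * (x - z).
    by apply: mulr_ge0; [have := Phi_lipschitz zc; lra|rewrite subr_ge0].
  lra.
have [c /andP[_ cz] E] := mean_value fd xz.
have : (Phi z + gauss 0 * (c - z) - Phi c) * (z - x) <= 0.
  by rewrite mulr_le0_ge0 ?subr_ge0//; have := Phi_lipschitz cz; lra.
lra.
Qed.

(** Second-order Taylor expansion: [gauss] is the second derivative of [pos_mean], and being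
    1-Lipschitz it leaves an error cubic in [h]. First [g], then its antiderivative [f], is shown to
    be nonnegative. *)
Lemma pos_mean_sign_le (R : realType) (z h : R) : 0 <= h ->
  (pos_mean (z + h) + pos_mean (z - h)) / 2 <=
  pos_mean z + gauss z * h ^+ 2 / 2 + h ^+ 3 / 2.
Proof.
move=> h0.
pose g (y : R) := 2 * gauss z * y + y ^+ 2 - Phi (z + y) + Phi (z - y).
have gd (y : R) : is_derive y 1 g
    (2 * gauss z + 2 * y - gauss (z + y) - gauss (z - y)).
  have d1 : is_derive y 1 (fun t => Phi (z + t)) (gauss (z + y)).
    have d0 : is_derive y 1 (fun t => z + t) 1 by apply: is_derive_eq; ring.
    have := @is_derive1_comp R (@Phi R) _ y _ _ (is_derive_Phi _) d0.
    by rewrite mulr1.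
  have d2 : is_derive y 1 (fun t => Phi (z - t)) (- gauss (z - y)).
    have d0 : is_derive y 1 (fun t => z - t) (-1) by apply: is_derive_eq; ring.
    have := @is_derive1_comp R (@Phi R) _ y _ _ (is_derive_Phi _) d0.
    by rewrite mulrN1.
  by apply: is_derive_eq; rewrite /GRing.scale /=; ring.
have g0 (y : R) : 0 <= y -> 0 <= g y.
  move=> y0; rewrite -[0](_ : g 0 = 0); last by rewrite /g addr0 subr0; ring.
  apply: derive_ge0_le gd y0 _ => x /andP[x0 _].
  have := gauss_lipschitz (z + x) z; have := gauss_lipschitz (z - x) z.
  rewrite [z + x - z]addrAC [z - x - z]addrAC !subrr !add0r normrN (ger0_norm x0).
  rewrite !ler_norml; lra.
pose f (y : R) := 2 * pos_mean z + gauss z * y ^+ 2 + y ^+ 3 / 3 - pos_mean (z + y) - pos_mean (z - y).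
have fd (y : R) : is_derive y 1 f (g y).
  have d1 : is_derive y 1 (fun t => pos_mean (z + t)) (Phi (z + y)).
    have d0 : is_derive y 1 (fun t => z + t) 1 by apply: is_derive_eq; ring.
    have := @is_derive1_comp R (@pos_mean R) _ y _ _ (is_derive_pos_mean _) d0.
    by rewrite mulr1.
  have d2 : is_derive y 1 (fun t => pos_mean (z - t)) (- Phi (z - y)).
    have d0 : is_derive y 1 (fun t => z - t) (-1) by apply: is_derive_eq; ring.
    have := @is_derive1_comp R (@pos_mean R) _ y _ _ (is_derive_pos_mean _) d0.
    by rewrite mulrN1.
  by apply: is_derive_eq; rewrite /GRing.scale /= /g; field.
have : f 0 <= f h by apply: derive_ge0_le fd h0 _ => x /andP[/g0].
have h3 : 0 <= h ^+ 3 by rewrite exprn_ge0.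
rewrite /f addr0 subr0 expr0n /= ; lra.
Qed.

(** For a standard Gaussian [g], [a * pos_mean (z / a)] is the mean of the positive part of
    [z + a g]. As the perspective of a convex function it is convex in [a], with slope [gauss z] at
    [a = 1]. *)
Lemma pos_mean_scale_ge (R : realType) (z a : R) : 0 < a ->
  pos_mean z + (a - 1) * gauss z <= a * pos_mean (z / a).
Proof.
move=> a0; have := ler_wpM2l (ltW a0) (pos_mean_tangent (z / a) z).
apply: le_trans; rewrite /pos_mean le_eqVlt; apply/orP; left; apply/eqP.
by field; rewrite gt_eqF.
Qed.

(** The slope in [a] of [a * pos_mean (y / a)] is [gauss (y / a)], which is below 1. *)
Lemma pos_mean_scale_le (R : realType) (y a : R) : 1 <= a ->
  a * pos_mean (y / a) <= pos_mean y + (a - 1).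
Proof.
move=> a1; have := pos_mean_tangent y (y / a).
set x := y / a; have -> : y = a * x by rewrite /x; field; rewrite gt_eqF; lra.
have : 0 <= (a - 1) * (1 - gauss x).
  by rewrite mulr_ge0 ?subr_ge0//; have := gauss_le0 x; have := gauss0_le R; lra.
have -> : pos_mean x = x * Phi x + gauss x by [].
lra.
Qed.

(** * The Davie-Reeds constant *)

Lemma lambdaE (R : realType) (x : R) : lambda x = 2 * x * gauss x.
Proof.
have s2 : Num.sqrt 2 * Num.sqrt 2 = 2 :> R by rewrite -expr2 sqr_sqrtr.
have p0 : Num.sqrt (pi : R) != 0 by rewrite gt_eqF// sqrtr_gt0 pi_gt0.
have s0 : Num.sqrt (2 : R) != 0 by rewrite gt_eqF// sqrtr_gt0.
rewrite /lambda /gauss sqrtrM// sqrtrM// sqrtrV ?pi_ge0//.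
rewrite -[X in _ = X * x * _]s2; set e := expR _.
by field; rewrite p0 s0.
Qed.

Lemma gauss_antimono (R : realType) (x y : R) : 0 <= x -> x <= y -> gauss y <= gauss x.
Proof.
move=> x0 xy; rewrite ler_pM2r ?invr_gt0 ?sqrtr_gt0 ?mulr_gt0 ?pi_gt0// ler_expR.
by rewrite lerN2 ler_pM2r ?invr_gt0// ler_sqr ?nnegrE// (le_trans x0).
Qed.

Lemma id_gauss_mono (R : realType) (x y : R) : 0 <= x -> x <= y -> y <= 1 ->
  x * gauss x <= y * gauss y.
Proof.
move=> x0 xy y1.
have fd (t : R) : is_derive t 1 (fun t => t * gauss t) ((1 - t ^+ 2) * gauss t).
  by apply: is_derive_eq; rewrite /GRing.scale /=; ring.
apply: derive_ge0_le fd xy _ => t /andP[xt ty].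
by rewrite mulr_ge0 ?(ltW (gauss_gt0 _))//; nra.
Qed.

(** As a function of its threshold [t], the objective has derivative [8 * gauss t * (y * gauss y - t
    * gauss t)]. Since [t * gauss t] increases on [0, 1], the maximum is at [t = y]. *)
Lemma davie_reeds_objective_le (R : realType) (x y : R) : 0 <= x <= 1 -> 0 <= y <= 1 ->
  4 * gauss x ^+ 2 - 8 * y * gauss y * Phi (- x) <=
  4 * gauss y ^+ 2 - 8 * y * gauss y * Phi (- y).
Proof.
move=> /andP[x0 x1] /andP[y0 y1].
pose f (t : R) := 4 * gauss t ^+ 2 - 8 * y * gauss y * Phi (- t).
have fd (t : R) : is_derive t 1 f (8 * gauss t * (y * gauss y - t * gauss t)).
  have d1 := @is_derive1_comp R (@Phi R) -%R t _ _ (is_derive_Phi _) (is_deriveNid _ _).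
  by apply: is_derive_eq; rewrite gaussN /GRing.scale /=; ring.
rewrite -subr_ge0 -/(f x) -/(f y).
case: (leP x y) => [xy|/ltW yx].
  have [c /andP[xc cy] ->] := mean_value fd xy; have g0 := gauss_gt0 c.
  apply: mulr_ge0; last by rewrite subr_ge0.
  by apply: mulr_ge0; [lra|rewrite subr_ge0; apply: id_gauss_mono; lra].
have [c /andP[yc cx] E] := mean_value fd yx; have g0 := gauss_gt0 c.
have : 0 <= 8 * gauss c * (c * gauss c - y * gauss y) * (x - y).
  apply: mulr_ge0; last by rewrite subr_ge0.
  by apply: mulr_ge0; [lra|rewrite subr_ge0; apply: id_gauss_mono; lra].
lra.
Qed.

(* Rewritten with [lambda t = 2 t gauss t], stationarity of [davie_reeds_fun] at [x]
   reads [4 * gauss x ^+ 2 = 4 * Phi (- x) - 1]. *)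
Lemma davie_reeds_constant_le (R : realType) (x : R) : 0 <= x <= 1 ->
  4 * gauss x ^+ 2 = 4 * Phi (- x) - 1 ->
  davie_reeds_constant R <= (4 * gauss x ^+ 2)^-1.
Proof.
move=> x01 xE; apply: ge_sup.
  by exists (davie_reeds_fun (1 / 2)), (1 / 2) => //=; rewrite in_itv /=; lra.
move=> _ [y /= + <-]; rewrite in_itv /= => /andP[y0 y1].
have g0 := gauss_gt0 x.
have a0 : 0 < 4 * gauss x ^+ 2 by rewrite mulr_gt0// exprn_gt0.
rewrite /davie_reeds_fun !lambdaE.
have -> : 2 * y * gauss y / y = 2 * gauss y by field; rewrite gt_eqF.
have l1 : 2 * y * gauss y < 1.
  by have := gauss_le0 y; have := gauss0_le R; have := gauss_gt0 y; nra.
have y01 : 0 <= y <= 1 by rewrite !ltW.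
have := davie_reeds_objective_le x01 y01 => H.
set l := 2 * y * gauss y in l1 *; set D := (X in _ / X).
(* [D] is [l] plus the objective at [y], hence at least [l] plus the objective at [x]; stationarity
   at [x] turns this last sum into [4 * gauss x ^+ 2 * (1 - l)]. *)
have aD : 4 * gauss x ^+ 2 * (1 - l) <= D.
  rewrite /D mulrBr mulr1 {2}xE /l; lra.
have D0 : 0 < D by apply: lt_le_trans aD; rewrite mulr_gt0// subr_gt0.
by rewrite ler_pdivrMr// mulrC ler_pdivlMr// mulrC.
Qed.

(** * Numerical bounds and the optimal threshold *)

(** Each bound integrates the previous one from 0, starting with [0 <= 1 - cos]. They serve to
    estimate [pi]. *)
Lemma sin_cos_taylor (R : realType) (x : R) : 0 <= x ->
  1 - x ^+ 2 / 2 <= cos x /\ x - x ^+ 3 / 6 <= sin x.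
Proof.
have sin_le (y : R) : 0 <= y -> 0 <= y - sin y.
  move=> y0; rewrite -[leLHS](_ : 0 - sin 0 = 0); last by rewrite sin0 subr0.
  apply: (@derive_ge0_le _ (fun t => t - sin t) (fun t => 1 - cos t)) => //.
have cos_ge (y : R) : 0 <= y -> 0 <= cos y - 1 + y ^+ 2 / 2.
  move=> y0; rewrite -[leLHS](_ : cos 0 - 1 + 0 ^+ 2 / 2 = 0); last first.
    by rewrite cos0 subrr expr0n /= mul0r addr0.
  apply: (@derive_ge0_le _ (fun t => cos t - 1 + t ^+ 2 / 2) (fun t => t - sin t)) => //.
    by move=> t; apply: is_derive_eq; rewrite /GRing.scale /=; field.
  by move=> t /andP[t0 _]; exact: sin_le.
move=> x0; split; first by have := cos_ge _ x0; lra.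
have : 0 <= sin x - x + x ^+ 3 / 6.
  rewrite -[leLHS](_ : sin 0 - 0 + 0 ^+ 3 / 6 = 0); last first.
    by rewrite sin0 subrr expr0n /= mul0r addr0.
  apply: (@derive_ge0_le _ (fun t => sin t - t + t ^+ 3 / 6)
    (fun t => cos t - 1 + t ^+ 2 / 2)) => //.
    by move=> t; apply: is_derive_eq; rewrite /GRing.scale /=; field.
  by move=> t /andP[t0 _]; exact: cos_ge.
lra.
Qed.

(** If [pi < 3] then [cos (3 / 2) <= 0], and if [16 / 5 < pi] then [0 <= cos (8 / 5)]. Double angle
    formulas reduce both to the Taylor bounds at 3/4 and 2/5, which contradict them. *)
Lemma pi_bounds (R : realType) : 3 <= (pi : R) <= 16 / 5.
Proof.
have c2 (x : R) : cos (x + x) = 2 * cos x ^+ 2 - 1.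
  by rewrite cosD -!expr2 sin2cos2; ring.
apply/andP; split; rewrite leNgt; apply/negP => H.
  have : cos (3 / 4 + 3 / 4 : R) <= 0.
    rewrite -[X in cos X](subrK (pi / 2)) cosDpihalf oppr_le0.
    by apply: sin_ge0_pi; have := pi_ge2 R; lra.
  have /sin_cos_taylor[] : 0 <= 3 / 4 :> R by lra.
  by rewrite c2; nra.
have : 0 <= cos (4 / 5 + 4 / 5 : R) by apply: cos_ge0_pihalf; lra.
have /sin_cos_taylor[] : 0 <= 2 / 5 :> R by lra.
rewrite c2 (_ : 4 / 5 = 2 / 5 + 2 / 5); last by field.
rewrite c2; have := cos2Dsin2 (2 / 5 : R).
set c := cos _; set s := sin _ => cs c1 s1.
have s2 : 15 / 100 <= s ^+ 2 by nra.
have c3 : 8 / 10 <= c ^+ 2 by nra.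
have -> : c ^+ 2 = 1 - s ^+ 2 by lra.
nra.
Qed.

Lemma gauss_sqr (R : realType) (x : R) :
  gauss x ^+ 2 = expR (- x ^+ 2) * gauss 0 ^+ 2.
Proof.
rewrite /gauss !expr_div_n sqr_sqrtr ?mulr_ge0 ?pi_ge0// -expRM_natl.
rewrite [0 ^+ 2]expr0n /= mul0r oppr0 expR0 expr1n mulrA mulr1.
by congr (expR _ / _); field.
Qed.

Lemma gauss0_bounds (R : realType) : 395 / 1000 <= gauss (0 : R) <= 41 / 100.
Proof.
have g0 := gauss_gt0 (0 : R).
have : gauss 0 ^+ 2 * (2 * pi) = 1 :> R.
  rewrite /gauss expr0n /= mul0r oppr0 expR0 mul1r exprVn sqr_sqrtr ?mulr_ge0 ?pi_ge0//.
  by rewrite mulVf// gt_eqF// mulr_gt0 ?pi_gt0.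
have /andP[p1 p2] := pi_bounds R => E.
by apply/andP; split; rewrite leNgt; apply/negP => H; nra.
Qed.

Lemma gauss_ge (R : realType) (x : R) : (1 - x ^+ 2 / 2) * gauss 0 <= gauss x.
Proof.
rewrite /gauss expr0n /= mul0r oppr0 expR0 mul1r ler_pM2r ?invr_gt0 ?sqrtr_gt0 ?mulr_gt0 ?pi_gt0//.
exact: expR_ge1Dx.
Qed.

Lemma davie_reeds_threshold (R : realType) : exists2 x : R,
  1 / 5 <= x <= 3 / 10 & 4 * gauss x ^+ 2 = 4 * Phi (- x) - 1.
Proof.
(* By [PhiN] the equation reads [k t = 3], to which the intermediate value theorem applies. *)
pose k (t : R) := 4 * Phi t + 4 * gauss t ^+ 2.
have kd (t : R) : is_derive t 1 k (4 * gauss t - 8 * t * gauss t ^+ 2).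
  by apply: is_derive_eq; rewrite /GRing.scale /=; ring.
have kc : {within `[1 / 5, 3 / 10], continuous k}.
  by apply: derivable_within_continuous => t _; have [] := kd t.
have /andP[g1 g2] := gauss0_bounds R.
have l : 1 / 5 <= 3 / 10 :> R by lra.
have k1 : k (1 / 5) <= 3.
  have z5 : 0 <= 1 / 5 :> R by lra.
  have := Phi_lipschitz z5; rewrite Phi0 /k gauss_sqr => H.
  have e : expR (- (1 / 5) ^+ 2) <= 25 / 26 :> R.
    rewrite expRN invf_ple ?posrE ?expR_gt0//.
    by apply: le_trans (expR_ge1Dx _); rewrite le_eqVlt; apply/orP; left; apply/eqP; field.
  have := expR_gt0 (- (1 / 5) ^+ 2 : R); nra.
have k2 : 3 <= k (3 / 10).
  have z3 : 0 <= 3 / 10 :> R by lra.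
  have [c /andP[c0 c3] E] := mean_value (@is_derive_Phi R) z3.
  have := gauss_antimono c0 c3; have := gauss_ge (3 / 10 : R).
  rewrite Phi0 in E; rewrite /k; nra.
have k12 := le_trans k1 k2.
have [|x] := @IVT R k _ _ 3 l kc; first by rewrite min_l// max_r// k1.
rewrite in_itv /= => x01 kx; exists x => //.
by rewrite PhiN; rewrite /k in kx; lra.
Qed.

(** * Sums of signs on the discrete cube *)

Definition avg (R : realType) (T : finType) (f : T -> R) : R :=
  #|T|%:R^-1 * \sum_t f t.

Lemma eq_avg (R : realType) (T : finType) (f g : T -> R) : f =1 g -> avg f = avg g.
Proof. by move=> fg; congr (_ * _); apply: eq_bigr => t _. Qed.

Lemma avgD (R : realType) (T : finType) (f g : T -> R) :
  avg (fun t => f t + g t) = avg f + avg g.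
Proof. by rewrite /avg big_split mulrDr. Qed.

Lemma avgZ (R : realType) (T : finType) (k : R) (f : T -> R) :
  avg (fun t => k * f t) = k * avg f.
Proof. by rewrite /avg -mulr_sumr mulrCA. Qed.

Lemma avgN (R : realType) (T : finType) (f : T -> R) :
  avg (fun t => - f t) = - avg f.
Proof. by rewrite /avg sumrN mulrN. Qed.

Lemma avgB (R : realType) (T : finType) (f g : T -> R) :
  avg (fun t => f t - g t) = avg f - avg g.
Proof. by rewrite avgD avgN. Qed.

Lemma avg_sum (R : realType) (T : finType) (I : Type) (s : seq I) (P : pred I)
    (f : I -> T -> R) :
  avg (fun t => \sum_(i <- s | P i) f i t) = \sum_(i <- s | P i) avg (f i).
Proof. by rewrite /avg exchange_big /= mulr_sumr. Qed.

Lemma le_avg (R : realType) (T : finType) (f g : T -> R) :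
  (forall t, f t <= g t) -> avg f <= avg g.
Proof. by move=> fg; rewrite ler_wpM2l ?invr_ge0 ?ler0n// ler_sum. Qed.

Lemma avg_ge0 (R : realType) (T : finType) (f : T -> R) :
  (forall t, 0 <= f t) -> 0 <= avg f.
Proof. by move=> f0; rewrite mulr_ge0 ?invr_ge0 ?ler0n// sumr_ge0. Qed.

(** The point [t] excludes the empty type, on which every average is 0. *)
Lemma avg_cst (R : realType) (T : finType) (t : T) (k : R) : avg (fun _ : T => k) = k.
Proof.
have T0 : #|T|%:R != 0 :> R by rewrite pnatr_eq0 -lt0n; apply/card_gt0P; exists t.
by rewrite /avg sumr_const -[k *+ _]mulr_natl mulrA mulVf// mul1r.
Qed.

Lemma avg_inj (R : realType) (T : finType) (h : T -> T) (f : T -> R) :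
  injective h -> avg (fun t => f (h t)) = avg f.
Proof. by move=> hI; congr (_ * _); rewrite [RHS](reindex_inj hI). Qed.

Definition flip (J : finType) (A : pred J) (w : {ffun J -> bool}) : {ffun J -> bool} :=
  [ffun j => w j (+) A j].

Lemma flipK (J : finType) (A : pred J) : involutive (flip A).
Proof. by move=> w; apply/ffunP => j; rewrite !ffunE addbK. Qed.

Definition coord_sign (R : realType) (J : finType) (w : {ffun J -> bool}) (j : J) : R :=
  (-1) ^+ w j.

(** The signs range over a list, so that moments can be computed by induction, one sign at a
    time. *)
Definition signed_sum (R : realType) (J : finType) (c : J -> R) (s : seq J)
  (w : {ffun J -> bool}) : R := \sum_(j <- s) c j * coord_sign R w j.

Lemma coord_sign_flip (R : realType) (J : finType) (A : pred J) w j :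
  coord_sign R (flip A w) j = if A j then - coord_sign R w j else coord_sign R w j.
Proof. by rewrite /coord_sign ffunE; case: (A j); case: (w j); rewrite /= ?expr1 ?expr0 ?opprK. Qed.

Lemma coord_sign_sqr (R : realType) (J : finType) w (j : J) : coord_sign R w j ^+ 2 = 1.
Proof. by rewrite /coord_sign; case: (w j); rewrite ?expr1 ?sqrrN ?expr0 expr1n. Qed.

Lemma signed_sum_cons (R : realType) (J : finType) (c : J -> R) j s w :
  signed_sum c (j :: s) w = c j * coord_sign R w j + signed_sum c s w.
Proof. by rewrite /signed_sum big_cons. Qed.

Lemma signed_sum_flip1 (R : realType) (J : finType) (c : J -> R) j s w : j \notin s ->
  signed_sum c s (flip (pred1 j) w) = signed_sum c s w.
Proof.
move=> js; apply: eq_big_seq => i si; rewrite coord_sign_flip /=.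
by case: eqP => // ij; rewrite -ij si in js.
Qed.

(** Integrates out the sign at [j]: this is the inductive step of all the moment computations
    below. *)
Lemma avg_flip1 (R : realType) (J : finType) (j : J) (f : {ffun J -> bool} -> R) :
  avg f = avg (fun w => (f w + f (flip (pred1 j) w)) / 2).
Proof.
under [RHS]eq_avg do rewrite mulrC.
by rewrite avgZ avgD (avg_inj _ (inv_inj (flipK (pred1 j)))); field.
Qed.

Lemma avg_signed_sum_sqr (R : realType) (J : finType) (c : J -> R) s : uniq s ->
  avg (fun w => signed_sum c s w ^+ 2) = \sum_(j <- s) c j ^+ 2.
Proof.
elim: s => [_|j s IH /= /andP[js us]].
  rewrite big_nil -[RHS](@avg_cst R {ffun J -> bool} [ffun=> true]).
  by apply: eq_avg => w; rewrite /signed_sum big_nil expr0n.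
rewrite (avg_flip1 j) big_cons -IH// -[c j ^+ 2](@avg_cst R {ffun J -> bool} [ffun=> true]).
rewrite -avgD; apply: eq_avg => w; have := coord_sign_sqr R w j.
rewrite !signed_sum_cons signed_sum_flip1// coord_sign_flip /= eqxx.
set x := coord_sign R w j; set y := signed_sum c s w => x2.
rewrite (_ : _ / 2 = c j ^+ 2 * x ^+ 2 + y ^+ 2); first by rewrite x2 mulr1.
by field.
Qed.

(** One more sign of coefficient [c] adds [6 c^2 S + c^4] to the fourth moment, [S] being the second
    moment of the rest, while the bound grows by [6 c^2 S + 3 c^4]. *)
Lemma avg_signed_sum_pow4 (R : realType) (J : finType) (c : J -> R) s : uniq s ->
  avg (fun w => signed_sum c s w ^+ 4) <= 3 * (\sum_(j <- s) c j ^+ 2) ^+ 2.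
Proof.
elim: s => [_|j s IH /= /andP[js us]].
  rewrite big_nil -[leRHS](@avg_cst R {ffun J -> bool} [ffun=> true]).
  by apply: le_avg => w; rewrite /signed_sum big_nil !expr0n /= mulr0.
rewrite (avg_flip1 j) big_cons.
have -> : avg (fun w => (signed_sum c (j :: s) w ^+ 4 +
    signed_sum c (j :: s) (flip (pred1 j) w) ^+ 4) / 2) =
    avg (fun w => signed_sum c s w ^+ 4) + 6 * c j ^+ 2 * (\sum_(j <- s) c j ^+ 2) + c j ^+ 4.
  rewrite -(avg_signed_sum_sqr c us) -avgZ -[c j ^+ 4](@avg_cst R {ffun J -> bool} [ffun=> true]).
  rewrite -!avgD; apply: eq_avg => w; have := coord_sign_sqr R w j.
  rewrite !signed_sum_cons signed_sum_flip1// coord_sign_flip /= eqxx.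
  set x := coord_sign R w j; set y := signed_sum c s w => x2.
  rewrite (_ : _ / 2 = y ^+ 4 + 6 * c j ^+ 2 * y ^+ 2 * x ^+ 2 + c j ^+ 4 * (x ^+ 2) ^+ 2).
    by rewrite x2; ring.
  by field.
have := IH us; set S := \sum_(_ <- _) _; nra.
Qed.

(** Let [S] be the sum of the squared norms so far. A further vector of squared norm [V] adds
    [2 V S + V ^+ 2] and four times the sum of its squared inner products with the others, which the
    hypothesis bounds by [V]. *)
Lemma avg_sqnorm_sqr (R : realType) (J I : finType) (v : J -> I -> R) s : uniq s ->
  (forall j, \sum_(l <- s) (\sum_i v j i * v l i) ^+ 2 <= \sum_i v j i ^+ 2) ->
  avg (fun w => (\sum_i signed_sum (v^~ i) s w ^+ 2) ^+ 2) <=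
  (\sum_(j <- s) \sum_i v j i ^+ 2) ^+ 2 + 4 * \sum_(j <- s) \sum_i v j i ^+ 2.
Proof.
elim: s => [_ _|j s IH /= /andP[js us] hv].
  rewrite !big_nil -[leRHS](@avg_cst R {ffun J -> bool} [ffun=> true]).
  apply: le_avg => w; rewrite big1 ?mulr0 ?addr0// => i _.
  by rewrite /signed_sum big_nil expr0n.
have hs j' : \sum_(l <- s) (\sum_i v j' i * v l i) ^+ 2 <= \sum_i v j' i ^+ 2.
  by apply: le_trans (hv j'); rewrite big_cons lerDr sqr_ge0.
rewrite (avg_flip1 j) !big_cons; set V := \sum_i v j i ^+ 2.
have -> : avg (fun w => ((\sum_i signed_sum (v^~ i) (j :: s) w ^+ 2) ^+ 2 +
     (\sum_i signed_sum (v^~ i) (j :: s) (flip (pred1 j) w) ^+ 2) ^+ 2) / 2) =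
    avg (fun w => (\sum_i signed_sum (v^~ i) s w ^+ 2) ^+ 2) +
    2 * V * (\sum_(j <- s) \sum_i v j i ^+ 2) + V ^+ 2 +
    4 * \sum_(l <- s) (\sum_i v j i * v l i) ^+ 2.
  rewrite -(avg_signed_sum_sqr _ us) -!avgZ.
  have -> : \sum_(j <- s) \sum_i v j i ^+ 2 = avg (fun w => \sum_i signed_sum (v^~ i) s w ^+ 2).
    rewrite exchange_big /= avg_sum; apply: eq_bigr => i _.
    by rewrite -(avg_signed_sum_sqr (v^~ i) us).
  rewrite -avgZ -[V ^+ 2](@avg_cst R {ffun J -> bool} [ffun=> true]).
  rewrite -!avgD; apply: eq_avg => w; have := coord_sign_sqr R w j.
  have E (e : R) : e ^+ 2 = 1 -> \sum_i (v j i * e + signed_sum (v^~ i) s w) ^+ 2 =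
      V + 2 * e * signed_sum (fun l => \sum_i v j i * v l i) s w +
      \sum_i signed_sum (v^~ i) s w ^+ 2.
    move=> e2; rewrite /V /signed_sum; under [X in _ = _ + 2 * e * X + _]eq_bigr do rewrite mulr_suml.
    rewrite exchange_big /= mulr_sumr -!big_split /=; apply: eq_bigr => i _.
    rewrite -/(signed_sum _ _ _).
    have -> : \sum_(l <- s) v j i * v l i * coord_sign R w l = v j i * signed_sum (v^~ i) s w.
      by rewrite /signed_sum mulr_sumr; apply: eq_bigr => l _; rewrite mulrA.
    rewrite (_ : v j i ^+ 2 = v j i ^+ 2 * e ^+ 2); first by rewrite /signed_sum; ring.
    by rewrite e2 mulr1.
  under eq_bigr do rewrite signed_sum_cons.
  under [X in _ + X ^+ 2]eq_bigr do rewrite signed_sum_cons signed_sum_flip1// coord_sign_flip /= eqxx.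
  move=> x2; rewrite !E ?sqrrN//.
  set x := coord_sign R w j in x2 *; set y := signed_sum _ s w; set Q := \sum_i _.
  rewrite (_ : _ / 2 = Q ^+ 2 + 2 * V * Q + V ^+ 2 + 4 * y ^+ 2 * x ^+ 2).
    by rewrite x2 mulr1.
  by field.
have := IH us hs; have := hs j; rewrite -/V.
set S := \sum_(_ <- _) \sum_ _ _; set P := \sum_(_ <- _) (_ ^+ 2); set A := avg _.
nra.
Qed.

(* One step of Lindeberg's replacement: a fair sign times [h] against a centered
   Gaussian of variance [h ^ 2]. *)
Lemma pos_mean_step (R : realType) (z h : R) : 0 <= h ->
  (pos_mean (z + h) + pos_mean (z - h)) / 2 <=
  Num.sqrt (1 + h ^+ 2) * pos_mean (z / Num.sqrt (1 + h ^+ 2)) + h ^+ 3.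
Proof.
move=> h0; have := pos_mean_sign_le z h0.
have h2 := sqr_ge0 h; have h3 := exprn_ge0 3 h0.
set a := Num.sqrt _.
have a2 : a ^+ 2 = 1 + h ^+ 2 by rewrite sqr_sqrtr//; lra.
have a0 : 0 < a by rewrite sqrtr_gt0; lra.
(* Expansion of the square root with a cubic error: for [h > 1] the left side is below 1, otherwise
   squares are compared. *)
have ha : 1 + h ^+ 2 / 2 - h ^+ 3 <= a.
  have a1 : 1 <= a by nra.
  case: (leP h 1) => h1; last by nra.
  rewrite leNgt; apply/negP => H.
  have : (1 + h ^+ 2 / 2 - h ^+ 3) ^+ 2 <= a ^+ 2.
    have h21 : h ^+ 2 <= 1 by nra.
    have h34 : h ^+ 2 * h ^+ 2 <= h ^+ 3 by nra.
    have h35 : 0 <= h ^+ 3 * h ^+ 2 by rewrite mulr_ge0.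
    have h36 : h ^+ 3 * h ^+ 3 <= h ^+ 3 by nra.
    rewrite a2; nra.
  by nra.
have := pos_mean_scale_ge z a0; have g0 := gauss_gt0 z.
have g1 : gauss z <= 1 / 2 by apply: le_trans (gauss_le0 z) (gauss0_le R).
have : gauss z * (1 + h ^+ 2 / 2 - h ^+ 3) <= gauss z * a by rewrite ler_pM2l.
have : gauss z * h ^+ 3 <= 1 / 2 * h ^+ 3 by rewrite ler_wpM2r.
lra.
Qed.

(* [Num.sqrt v * pos_mean (y / Num.sqrt v)] is the mean of [max 0 (y + g)] for a
   centered Gaussian [g] of variance [v]. *)
Lemma pos_mean_step_scaled (R : realType) (v y c : R) : 0 < v ->
  (Num.sqrt v * pos_mean ((y + c) / Num.sqrt v) +
   Num.sqrt v * pos_mean ((y - c) / Num.sqrt v)) / 2 <=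
  Num.sqrt (v + c ^+ 2) * pos_mean (y / Num.sqrt (v + c ^+ 2)) + `|c| ^+ 3 / v.
Proof.
move=> v0; wlog c0 : c / 0 <= c => [H|].
  case: (leP 0 c) => [/H//|/ltW]; rewrite -oppr_ge0 => /H.
  by rewrite sqrrN opprK normrN addrC.
set a := Num.sqrt v.
have a0 : 0 < a by rewrite sqrtr_gt0.
have a2 : v = a ^+ 2 by rewrite sqr_sqrtr// ltW.
have h0 : 0 <= c / a by rewrite divr_ge0// ltW.
have -> : v + c ^+ 2 = a ^+ 2 * (1 + (c / a) ^+ 2).
  by rewrite a2; field; rewrite gt_eqF.
rewrite sqrtrM ?sqr_ge0// sqrtr_sqr (gtr0_norm a0) (ger0_norm c0).
have := ler_wpM2l (ltW a0) (pos_mean_step (y / a) h0).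
rewrite -mulrDl -mulrBl; set S := Num.sqrt _.
have S0 : 0 < S by rewrite sqrtr_gt0; have := sqr_ge0 (c / a); lra.
have -> : y / a / S = y / (a * S) by field; rewrite !gt_eqF.
have -> : a * (S * pos_mean (y / (a * S)) + (c / a) ^+ 3) =
  a * S * pos_mean (y / (a * S)) + c ^+ 3 / v by rewrite a2; field; rewrite gt_eqF.
by apply: le_trans; rewrite le_eqVlt; apply/orP; left; apply/eqP; field.
Qed.

(** Lindeberg's method: the signs are replaced one by one by Gaussians of the same variance, which
    are merged into [v]. Each replacement costs [|c j| ^+ 3 / v0], as the Gaussian part always keeps
    variance at least [v0]. *)
Lemma avg_Nint_signed_sum_le (R : realType) (J : finType) (c : J -> R) s (v0 : R) :
  0 < v0 -> uniq s -> forall v y, v0 <= v ->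
  avg (fun w => Num.sqrt v * pos_mean ((y + signed_sum c s w) / Num.sqrt v)) <=
  Num.sqrt (v + \sum_(j <- s) c j ^+ 2) *
    pos_mean (y / Num.sqrt (v + \sum_(j <- s) c j ^+ 2)) +
  (\sum_(j <- s) `|c j| ^+ 3) / v0.
Proof.
move=> v00; elim: s => [_ v y vv0|j s IH /= /andP[js us] v y vv0].
  rewrite !big_nil mul0r !addr0 -[leRHS](@avg_cst R {ffun J -> bool} [ffun=> true]).
  by apply: le_avg => w; rewrite /signed_sum big_nil addr0.
have v1 : v0 <= v + c j ^+ 2 by rewrite (le_trans vv0)// lerDl sqr_ge0.
rewrite (avg_flip1 j) !big_cons addrA mulrDl addrCA.
apply: le_trans (lerD (lexx (`|c j| ^+ 3 / v0)) (IH us _ y v1)).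
rewrite -[_ / v0](@avg_cst R {ffun J -> bool} [ffun=> true]) -avgD.
apply: le_avg => w; rewrite !signed_sum_cons signed_sum_flip1// coord_sign_flip /= eqxx.
set x := coord_sign R w j; set S := signed_sum c s w.
have vp : 0 < v by apply: lt_le_trans vv0.
have x1 : `|c j * x| = `|c j|.
  by rewrite normrM /x /coord_sign normrX normrN1 expr1n mulr1.
have := pos_mean_step_scaled (y + S) (c j * x) vp.
rewrite exprMn coord_sign_sqr mulr1 x1.
have -> : y + (c j * x + S) = y + S + c j * x by ring.
have -> : y + (c j * - x + S) = y + S - c j * x by ring.
move=> /le_trans; apply.
by rewrite addrC lerD2r ler_wpM2l ?exprn_ge0// lef_pV2.
Qed.

(** Adding an independent Gaussian of variance [v] can only increase the mean of a convex function
    and makes Lindeberg's method available, with total error at most [d / v]. Going back from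
    variance [1 + v] to 1 costs at most [v]. *)
Lemma avg_pos_part_le (R : realType) (J : finType) (c : J -> R) s (v d y : R) :
  uniq s -> 0 < v -> \sum_(j <- s) c j ^+ 2 = 1 -> (forall j, `|c j| <= d) ->
  avg (fun w => Num.max 0 (y + signed_sum c s w)) <= pos_mean y + v + d / v.
Proof.
move=> us v0 c1 cd.
have sv0 : 0 < Num.sqrt v by rewrite sqrtr_gt0.
apply: (@le_trans _ _ (avg (fun w => Num.sqrt v * pos_mean ((y + signed_sum c s w) / Num.sqrt v)))).
  apply: le_avg => w; rewrite ge_max mulr_ge0 ?pos_mean_ge0 ?sqrtr_ge0//=.
  apply: le_trans (ler_wpM2l (ltW sv0) (pos_mean_ge _)).
  by rewrite mulrC divfK// gt_eqF.
apply: (le_trans (avg_Nint_signed_sum_le c v0 us y (lexx v))).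
rewrite c1; apply: lerD; last first.
  rewrite ler_pM2r ?invr_gt0// -[d]mulr1 -c1 mulr_sumr ler_sum// => j _.
  by rewrite -[c j ^+ 2]real_normK ?num_real// exprS ler_wpM2r ?sqr_ge0.
set a := Num.sqrt (v + 1).
have a2 : a ^+ 2 = v + 1 by rewrite sqr_sqrtr//; lra.
have a0 : 0 <= a by exact: sqrtr_ge0.
have a1 : 1 <= a by nra.
have := pos_mean_scale_le y a1; nra.
Qed.

(** The excess of [|x|] over [t] is at most the sum of the positive parts of [x - t] and
    [- x - t]. *)
Lemma avg_threshold_le (R : realType) (J : finType) (c : J -> R) s (v d t : R) :
  uniq s -> 0 < v -> \sum_(j <- s) c j ^+ 2 = 1 -> (forall j, `|c j| <= d) ->
  avg (fun w => Num.max 0 (`|signed_sum c s w| - t)) <= 2 * (pos_mean (- t) + v + d / v).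
Proof.
move=> us v0 c1 cd; have H1 := avg_pos_part_le (- t) us v0 c1 cd.
have c1' : \sum_(j <- s) (- c j) ^+ 2 = 1.
  by rewrite -c1; apply: eq_bigr => j _; rewrite sqrrN.
have cd' j : `|- c j| <= d by rewrite normrN.
have H2 := avg_pos_part_le (- t) us v0 c1' cd'.
apply: le_trans (_ : _ + _ <= _); last by rewrite mulr_natl mulr2n; exact: lerD H1 H2.
rewrite -avgD; apply: le_avg => w.
have -> : signed_sum (fun j => - c j) s w = - signed_sum c s w.
  by rewrite /signed_sum -sumrN; apply: eq_bigr => j _; rewrite mulNr.
have m0 (u : R) : 0 <= Num.max 0 u by rewrite le_max lexx.
have m1 (u : R) : u <= Num.max 0 u by rewrite le_max lexx orbT.
set x := signed_sum c s w; rewrite ge_max addr_ge0//=.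
have := m0 (- t + x); have := m0 (- t - x); have := m1 (- t + x); have := m1 (- t - x).
by case: (ger0P x) => _; lra.
Qed.

(** * The perturbed form on signs *)

(* The maximum over [r] of the left-hand side, convex in [r], is at an endpoint; at
   the upper one the main part is [<= - q^2 / 5], which absorbs the [O(e q)] part of
   the perturbation. *)
Lemma perturbed_optimum (R : realType) (eta r0 k b e eB h d r p : R) :
  1 / 5 <= eta <= 3 / 10 -> 0 < r0 -> 56 / 100 <= r0 ^+ 2 <= 673 / 1000 ->
  59 / 100 <= k <= 605 / 1000 -> 0 < b <= 1 / 10 -> 0 < e <= b / 1000 ->
  0 <= eB <= b / 10 ->
  h * eta = 4 -> 0 <= d <= 1 / 10 -> 0 <= r -> 0 <= p <= 1 ->
  let q := p - (1 + r0 ^+ 2) / 2 in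
  r <= r0 + eta * q - k * q ^+ 2 + d ->
  (1 + e * (1 - 2 * b)) * r ^+ 2 - eta * r0 * (2 * p - 1) +
    e * (1 - 2 * p + eB +
         h * (r0 - eta * ((1 + r0 ^+ 2) / 2) + d - (r - eta * p))) <=
  r0 ^+ 2 * (1 - eta * r0) - e * b + 4 * d.
Proof.
move=> /andP[n1 n2] r00 /andP[a1 a2] /andP[k1 k2] /andP[b0 b1] /andP[e0 e1].
move=> /andP[eB0 eB1] hn /andP[d0 d1] r_ge0 /andP[p0 p1] q.
set a := r0 ^+ 2 in a1 a2 q *.
have qE : p = (1 + a) / 2 + q by rewrite /q; ring.
have r01 : 748 / 1000 <= r0.
  by move: r00 a1; rewrite /a; clear; nra.
have r02 : r0 <= 821 / 1000.
  by move: r00 a2; rewrite /a; clear; nra.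
have h0 : 0 < h by move: hn n1; clear; nra.
have h1 : h <= 20 by move: hn n1 h0; clear; nra.
have nr : eta * r0 <= 2463 / 10000 by move: n1 n2 r01 r02; clear; nra.
have nr0 : 0 <= eta * r0 by move: n1 r00; clear; nra.
set A := 1 + e * (1 - 2 * b).
have A1 : 1 <= A by rewrite /A; move: e0 b1; clear; nra.
have A2 : A <= 1001 / 1000 by rewrite /A; move: b0 e0 e1 b1; clear; nra.
set w := eta * q - k * q ^+ 2; set Y := r0 + w + d => rY.
have {}rY : r <= Y by move: rY; rewrite /Y /w; clear; lra.
(* The terms in [r] add up to [r * (A * r - e * h)]. If this is nonpositive, crude numerical bounds
   suffice; otherwise it only grows when [r] is replaced by its upper bound [Y]. *)
case: (leP (r * (A * r - e * h)) 0) => [rneg|rpos].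
  have e2 : e * (1 - 2 * p + eB + h * (r0 - eta * ((1 + a) / 2) + d + eta * p)) <= e * 30.
    rewrite ler_pM2l//.
    have -> : h * (r0 - eta * ((1 + a) / 2) + d + eta * p) =
        h * (r0 + d) + h * eta * (p - (1 + a) / 2) by ring.
    rewrite hn; have : h * (r0 + d) <= 20 * (r0 + d).
      by rewrite ler_wpM2r//; move: r00 d0; clear; lra.
    by move: a1 p0 p1 eB1 b1 r02 d1; clear; lra.
  have e3 : e * b <= 1 / 10000 by move: e0 e1 b0 b1; clear; nra.
  have e4 : - (eta * r0 * (2 * p - 1)) <= eta * r0.
    by move: nr0 p0; clear; set x := eta * r0; nra.
  have e5 : 422 / 1000 <= a * (1 - eta * r0).
    by move: a1 nr; clear; set x := eta * r0; nra.
  move: e2 e3 e4 e5 rneg nr e1 b1 d0; clear; lra.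
have AY : r * (A * r - e * h) <= Y * (A * Y - e * h).
  have r_gt0 : 0 < r.
    by rewrite lt_neqAle r_ge0 andbT; apply/eqP => r0'; move: rpos; rewrite -r0' mul0r ltxx.
  have p2 : 0 < A * r - e * h by move: rpos; rewrite pmulr_rgt0.
  have p3 : A * r <= A * Y by rewrite ler_pM2l//; move: A1; clear; lra.
  apply: ler_pM => //; first exact: ltW.
  by move: p3; clear; lra.
have qb1 : - (84 / 100) <= q by move: a2 p0; rewrite /q; clear; lra.
have qb2 : q <= 22 / 100 by move: a1 p1; rewrite /q; clear; lra.
have q2 := sqr_ge0 q.
have w20 := sqr_ge0 w.
(* Against [2 r0 k >= 88 / 100] in the expansion [zE], this leaves [- 22 / 100 * q ^+ 2] to absorb
   the perturbation terms in [q]. *)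
have w2 : w ^+ 2 <= 66 / 100 * q ^+ 2.
  set m := eta - k * q.
  have wE : w = q * m by rewrite /w /m; ring.
  have m1 : 0 <= m by rewrite /m; move: n1 k1 k2 qb2; clear; nra.
  have m2 : m <= 81 / 100 by rewrite /m; move: n2 k1 k2 qb1; clear; nra.
  by rewrite wE exprMn mulrC ler_wpM2r//; move: m1 m2; clear; nra.
have zE : (r0 + w) ^+ 2 = a + 2 * (eta * r0) * q - 2 * r0 * k * q ^+ 2 + w ^+ 2.
  by rewrite /a /w; ring.
have rk : 88 / 100 * q ^+ 2 <= 2 * r0 * k * q ^+ 2.
  by rewrite ler_wpM2r//; move: r01 k1; clear; nra.
have zb : (r0 + w) <= 9 / 10.
  have : w <= eta * q by rewrite /w gerBl mulr_ge0//; move: k1; clear; lra.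
  have : eta * q <= 3 / 10 * (22 / 100) by move: n1 n2 qb2; clear; nra.
  by move: r02; clear; lra.
have Y2 : A * Y ^+ 2 <= A * (r0 + w) ^+ 2 + 3 * d.
  have -> : Y ^+ 2 = (r0 + w) ^+ 2 + d * (2 * (r0 + w) + d) by rewrite /Y; ring.
  rewrite mulrDr lerD2l mulrCA [leRHS]mulrC ler_wpM2l//.
  by move: zb d1 A1 A2; clear; nra.
have hk : h * (r0 - eta * ((1 + a) / 2) + d - (Y - eta * p)) <= 13 * q ^+ 2.
  have -> : r0 - eta * ((1 + a) / 2) + d - (Y - eta * p) = k * q ^+ 2.
    by rewrite /Y /w qE; ring.
  by rewrite mulrA ler_wpM2r//; move: h0 h1 k1 k2; clear; nra.
set Q := `|q|.
have Q0 : 0 <= Q by exact: normr_ge0.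
have Qq : q ^+ 2 = Q * Q by rewrite -expr2 real_normK ?num_real.
have [Qa Qb] : q <= Q /\ - q <= Q by rewrite /Q ler_norm -normrN ler_norm.
have key : e * ((1 - 2 * b) * (r0 + w) ^+ 2 - a - 2 * q + 13 * q ^+ 2) <=
    e * (5 / 2 * Q + 13 * (Q * Q) - 2 * b * a).
  rewrite ler_pM2l// -Qq.
  have f1 : (r0 + w) ^+ 2 - a <= Q / 2.
    have : (eta * r0) * q <= 2463 / 10000 * Q.
      by move: nr nr0 Qa Q0; clear; set x := eta * r0; nra.
    by move: zE w2 rk q2 Q0; clear; lra.
  have : (1 - 2 * b) * ((r0 + w) ^+ 2 - a) <= Q / 2.
    by move: f1 b0 b1 Q0; clear; set x := _ - a; nra.
  by move: Qb; clear; lra.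
have key2 : e * (5 / 2 * Q) <= Q * Q / 10 + 16 * (e * (b / 1000)).
  have : e * e <= e * (b / 1000) by rewrite ler_pM2l.
  by have := sqr_ge0 (Q - 25 / 2 * e); have := sqr_ge0 e; clear; lra.
have key3 : e * (13 * (Q * Q)) <= Q * Q / 100.
  have s1 : e <= 1 / 10000 by move: e1 b1; clear; lra.
  have s2 : 0 <= Q * Q by rewrite mulr_ge0.
  by move: s1 s2; clear; nra.
(* The gain [2 e b a] is at least [112 / 100 * (e * b)]; [key2] uses up [16 / 1000] of [e * b] and
   [eb] another tenth, so more than [e * b] remains. *)
have key4 : 56 / 100 * (e * b) <= e * (b * a).
  by rewrite [leRHS]mulrA [leLHS]mulrC ler_wpM2l// ltW// mulr_gt0.
have eb : e * eB <= e * (b / 10) by rewrite ler_pM2l.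
have hk' := ler_wpM2l (ltW e0) hk.
have AE : A * (r0 + w) ^+ 2 =
    (r0 + w) ^+ 2 + e * ((1 - 2 * b) * (r0 + w) ^+ 2) by rewrite /A; ring.
have eb0 : 0 < e * b by rewrite mulr_gt0.
have pE : eta * r0 * (2 * p - 1) = eta * r0 * a + 2 * (eta * r0) * q by rewrite qE; field.
have qQ : e * (1 - 2 * p) = e * (- a - 2 * q) by rewrite qE; field.
rewrite pE.
have qQ2 : 0 <= Q * Q by rewrite mulr_ge0.
have -> : e * (1 - 2 * p + eB + h * (r0 - eta * ((1 + a) / 2) + d - (r - eta * p))) =
  e * (1 - 2 * p) + e * eB +
  e * (h * (r0 - eta * ((1 + a) / 2) + d - (Y - eta * p))) + e * h * Y - e * h * r by ring.
rewrite qQ; rewrite Qq in zE w2 rk key hk'.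
move: AY Y2 zE w2 rk key key2 key3 key4 eb hk' AE eb0 qQ2 d0.
set U := e * (h * _); set z2 := (r0 + w) ^+ 2; set w' := w ^+ 2.
clear; move=> AY Y2 zE w2 rk key key2 key3 key4 eb hk' AE eb0 qQ2 d0.
lra.
Qed.

(* Deficit, at level [eta], of a choice [s] in {-1, 0, 1} at a point where the
   linear form has value [x]; two choices of opposite signs at nearby points have
   total deficit at least [eta]. *)
Lemma opposite_choices_le (R : realType) (eta x y s t : R) : 0 < eta ->
  [\/ s = 0, s = 1 | s = -1] -> [\/ t = 0, t = 1 | t = -1] ->
  (s * t) ^+ 2 - s * t <=
  2 * ((x - y) ^+ 4 / eta ^+ 4 +
    ((Num.max 0 (`|x| - eta) - (s * x - eta * s ^+ 2)) +
     (Num.max 0 (`|y| - eta) - (t * y - eta * t ^+ 2))) / eta).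
Proof.
move=> e0.
have m0 (u : R) : 0 <= Num.max 0 u by rewrite le_max lexx.
have m1 (u : R) : u <= Num.max 0 u by rewrite le_max lexx orbT.
have def_ge0 (z u : R) : [\/ u = 0, u = 1 | u = -1] ->
    0 <= Num.max 0 (`|z| - eta) - (u * z - eta * u ^+ 2).
  have := m0 (`|z| - eta); have := m1 (`|z| - eta).
  have := ler_norm z; have := ler_norm (- z); rewrite normrN.
  by move=> ? ? ? ? [] ->; rewrite ?sqrrN ?expr1n ?expr0n /=; lra.
have pos (z : R) : 0 <= z ^+ 4 / eta ^+ 4.
  by rewrite divr_ge0 ?exprn_even_ge0 ?exprn_ge0 ?ltW.
have opp (z1 z2 : R) : 1 <= (z1 - z2) ^+ 4 / eta ^+ 4 +
   ((Num.max 0 (`|z1| - eta) - (z1 - eta)) + (Num.max 0 (`|z2| - eta) - (- z2 - eta))) / eta.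
  set D := (X in _ <= _ + X / eta).
  have D2 : 2 * eta - (z1 - z2) <= D.
    by rewrite /D; have := m0 (`|z1| - eta); have := m0 (`|z2| - eta); lra.
  case: (leP (z1 - z2) eta) => h.
    have : 1 <= D / eta by rewrite ler_pdivlMr// mul1r; lra.
    by have := pos (z1 - z2); lra.
  have D0 : 0 <= D / eta.
    rewrite divr_ge0 ?(ltW e0)// /D.
    have := m1 (`|z1| - eta); have := m1 (`|z2| - eta).
    have := ler_norm z1; have := ler_norm (- z2); rewrite normrN; lra.
  have : 1 <= (z1 - z2) ^+ 4 / eta ^+ 4.
    by rewrite ler_pdivlMr ?exprn_gt0// mul1r lerXn2r ?nnegrE//; lra.
  lra.
move=> sv tv.
have [ds dt] := (def_ge0 x s sv, def_ge0 y t tv).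
have trivial : (s * t) ^+ 2 - s * t = 0 -> (s * t) ^+ 2 - s * t <= 2 * ((x - y) ^+ 4 / eta ^+ 4 +
    ((Num.max 0 (`|x| - eta) - (s * x - eta * s ^+ 2)) +
     (Num.max 0 (`|y| - eta) - (t * y - eta * t ^+ 2))) / eta).
  move=> ->; apply: mulr_ge0 => //; apply: addr_ge0 => //.
  by apply: divr_ge0; [exact: addr_ge0|exact: ltW].
case: sv tv => sE; case=> tE; try (by apply: trivial; rewrite sE tE; ring).
  by have := opp x y; rewrite sE tE sqrrN expr1n !mul1r !mulN1r mulr1 sqrrN expr1n; lra.
have := opp y x; rewrite sE tE sqrrN expr1n !mul1r !mulN1r mulr1 sqrrN expr1n.
have -> : (y - x) ^+ 4 = (x - y) ^+ 4 by ring.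
lra.
Qed.

Lemma choice_le (R : realType) (t x s : R) : [\/ s = 0, s = 1 | s = -1] ->
  s * x <= t * s ^+ 2 + Num.max 0 (`|x| - t).
Proof.
have m0 : 0 <= Num.max 0 (`|x| - t) by rewrite le_max lexx.
have m1 : `|x| - t <= Num.max 0 (`|x| - t) by rewrite le_max lexx orbT.
have := ler_norm x; have := ler_norm (- x); rewrite normrN.
by move=> ? ? [] ->; rewrite ?sqrrN ?expr1n ?expr0n /=; lra.
Qed.

(** The direction of [a], or a basis vector if [a = 0]: it turns the norm of the projection of a
    function on the linear forms into a correlation with a single linear form. *)
Lemma unit_direction (R : realType) (I : finType) (i0 : I) (a : I -> R) :
  exists u : I -> R, \sum_i u i ^+ 2 = 1 /\
    0 <= \sum_i u i * a i /\ \sum_i a i ^+ 2 = (\sum_i u i * a i) ^+ 2.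
Proof.
set S := \sum_i a i ^+ 2.
have S0 : 0 <= S by apply: sumr_ge0 => i _; exact: sqr_ge0.
move: (S0); rewrite le_eqVlt => /predU1P[S00|Sp].
  exists (fun i => (i == i0)%:R); have a0 i : a i = 0.
    have /eqP := esym S00; rewrite psumr_eq0 => [|j _]; last exact: sqr_ge0.
    by move=> /allP /(_ i); rewrite mem_index_enum sqrf_eq0 => /(_ isT) /eqP.
  have -> : \sum_i (i == i0)%:R * a i = 0 by rewrite big1// => i _; rewrite a0 mulr0.
  rewrite -S00 expr0n; split=> //.
  rewrite (bigD1 i0)//= eqxx expr1n big1 ?addr0// => i /negbTE ->.
  by rewrite expr0n.
have q0 : 0 < Num.sqrt S by rewrite sqrtr_gt0.
have q2 : Num.sqrt S ^+ 2 = S by rewrite sqr_sqrtr.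
exists (fun i => a i / Num.sqrt S).
have -> : \sum_i a i / Num.sqrt S * a i = Num.sqrt S.
  under eq_bigr do rewrite mulrAC -expr2.
  by rewrite -mulr_suml -/S -{1}q2 expr2 mulfK// gt_eqF.
split; last by split; [exact: ltW|].
under eq_bigr do rewrite expr_div_n.
by rewrite -mulr_suml -/S q2 divff// gt_eqF.
Qed.

(** With [d = (f - g) / 2] one has [|d| = 1 - s ^+ 2], so pointwise the form is at most
    [1 - s^2 - s'^2 + ((s s')^2 - s s')], primes denoting values at [tau t]. The last bracket is 2
    where [s] and [s'] are opposite and 0 elsewhere; [opposite_choices_le] charges it to the
    deficits and to the fourth power of the displacement of [L]. *)
Lemma avg_noise_le (R : realType) (T : finType) (t0 : T) (tau : T -> T) (f g s L : T -> R) (eta M : R) :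
  involutive tau -> 0 < eta ->
  (forall t, f t = 1 \/ f t = -1) -> (forall t, g t = 1 \/ g t = -1) ->
  avg (fun t => (L t - L (tau t)) ^+ 4) <= M ->
  (forall t, s t = (f t + g t) / 2) ->
  - avg (fun t => f t * g (tau t)) <=
  1 - 2 * avg (fun t => s t ^+ 2) + 2 * (M / eta ^+ 4) +
  4 / eta * (avg (fun t => Num.max 0 (`|L t| - eta)) -
             (avg (fun t => s t * L t) - eta * avg (fun t => s t ^+ 2))).
Proof.
move=> tauK e0 f1 g1 LM sE.
pose d t := (f t - g t) / 2.
pose D t := Num.max 0 (`|L t| - eta) - (s t * L t - eta * s t ^+ 2).
have sv t : [\/ s t = 0, s t = 1 | s t = -1].
  rewrite sE; case: (f1 t) (g1 t) => [] -> [] ->.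
  - by apply: Or32; field.
  - by apply: Or31; field.
  - by apply: Or31; field.
  - by apply: Or33; field.
have tI := inv_inj tauK.
have swap : avg (fun t => s t * d (tau t)) = avg (fun t => d t * s (tau t)).
  rewrite -(avg_inj _ tI); apply: eq_avg => t; rewrite tauK mulrC //.
(* The cross terms cancel because [tau] is a measure-preserving involution. *)
have -> : - avg (fun t => f t * g (tau t)) =
    avg (fun t => - (s t * s (tau t)) + d t * d (tau t)).
  rewrite -avgN -[RHS]addr0 -(subrr (avg (fun t => s t * d (tau t)))) {2}swap.
  by rewrite -avgB -avgD; apply: eq_avg => t; rewrite !sE /d; field.
have dd t : d t * d (tau t) <= (1 - s t ^+ 2) * (1 - s (tau t) ^+ 2).
  by rewrite !sE /d; case: (f1 t) (g1 t) (f1 (tau t)) (g1 (tau t)) => [] -> [] -> [] -> [] ->; lra.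
have pw t : - (s t * s (tau t)) + d t * d (tau t) <=
    (1 - s t ^+ 2 - s (tau t) ^+ 2) +
    (2 * eta ^- 4 * (L t - L (tau t)) ^+ 4 + (2 * eta^-1) * D t + (2 * eta^-1) * D (tau t)).
  have := opposite_choices_le (L t) (L (tau t)) e0 (sv t) (sv (tau t)).
  rewrite -/(D t) -/(D (tau t)); have := dd t; lra.
apply: (le_trans (le_avg pw)).
have es : avg (fun t => s (tau t) ^+ 2) = avg (fun t => s t ^+ 2).
  exact: (avg_inj (fun t => s t ^+ 2) tI).
have eD : avg (fun t => D (tau t)) = avg D by exact: (avg_inj D tI).
have aD : avg D = avg (fun t => Num.max 0 (`|L t| - eta)) -
             (avg (fun t => s t * L t) - eta * avg (fun t => s t ^+ 2)).
  by rewrite /D !(avgD, avgN, avgZ).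
clearbody D.
rewrite !(avgD, avgN, avgZ) (avg_cst t0) es eD aD.
have : eta ^- 4 * avg (fun t => (L t - L (tau t)) ^+ 4) <= eta ^- 4 * M.
  by rewrite ler_wpM2l// invr_ge0 exprn_ge0// ltW.
lra.
Qed.

(** The linear part is the squared norm of the projection of [s] minus that of [dd], hence at most
    [r ^+ 2]. All terms are thus bounded through [r] and the mean [p] of [s ^+ 2], and
    [perturbed_optimum] applies. *)
Lemma scalar_value_le (R : realType) (T I : finType) (i0 : I) (t0 : T) (B : nat)
    (X : I -> T -> R) (tau : 'I_B -> T -> T) (f g : T -> R) (eta e d : R) :
  (0 < B)%N -> B%:R^-1 <= 10 ^- 6 :> R -> 0 < e <= B%:R^-1 / 1000 -> 0 <= d <= 1 / 10 ->
  1 / 5 <= eta <= 3 / 10 -> 4 * gauss eta ^+ 2 = 4 * Phi (- eta) - 1 ->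
  (forall b, involutive (tau b)) ->
  (forall t, f t = 1 \/ f t = -1) -> (forall t, g t = 1 \/ g t = -1) ->
  (forall u : I -> R, \sum_i u i ^+ 2 = 1 ->
    (forall t, avg (fun w => Num.max 0 (`|\sum_i u i * X i w| - t)) <= 2 * pos_mean (- t) + d) /\
    (forall b, avg (fun w => (\sum_i u i * X i w - \sum_i u i * X i (tau b w)) ^+ 4) <=
       48 * B%:R^-1 ^+ 2)) ->
  (1 + e * (1 - 2 * B%:R^-1)) *
      (\sum_i avg (fun w => f w * X i w) * avg (fun w => g w * X i w)) -
    eta * (2 * gauss eta) * avg (fun w => f w * g w) -
    e * (B%:R^-1 * \sum_b avg (fun w => f w * g (tau b w))) <=
  4 * gauss eta ^+ 2 * (1 - eta * (2 * gauss eta)) - e * B%:R^-1 + 4 * d.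
Proof.
move=> B0 Bb /andP[e0 e1] /andP[d0 d1] /andP[n1 n2] aE tauK f1 g1 hX.
set b := B%:R^-1 in Bb e1 hX *.
have b0 : 0 < b by rewrite invr_gt0 ltr0n.
have {}Bb : b <= 1 / 1000 * (1 / 1000).
  by apply: (le_trans Bb); rewrite le_eqVlt; apply/orP; left; apply/eqP; field.
pose s t := (f t + g t) / 2; pose dd t := (f t - g t) / 2.
have sv t : [\/ s t = 0, s t = 1 | s t = -1].
  rewrite /s; case: (f1 t) (g1 t) => [] -> [] ->.
  - by apply: Or32; field.
  - by apply: Or31; field.
  - by apply: Or31; field.
  - by apply: Or33; field.
have [u [u1 [r_ge0 rE]]] := unit_direction i0 (fun i => avg (fun w => s w * X i w)).
have [hG hM] := hX u u1.
pose L w := \sum_i u i * X i w.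
set r := \sum_i u i * _ in r_ge0 rE.
have rL : r = avg (fun w => s w * L w).
  rewrite /r /L; under [RHS]eq_avg do rewrite mulr_sumr.
  by rewrite avg_sum; apply: eq_bigr => i _; rewrite -avgZ; apply: eq_avg => w; rewrite mulrCA.
pose p := avg (fun w => s w ^+ 2).
have p01 : 0 <= p <= 1.
  rewrite avg_ge0 => [|w]; last exact: sqr_ge0.
  rewrite -[leRHS](avg_cst t0) le_avg// => w.
  by case: (sv w) => ->; rewrite ?sqrrN ?expr1n ?expr0n.
have quad : \sum_i avg (fun w => f w * X i w) * avg (fun w => g w * X i w) <= r ^+ 2.
  rewrite -rE ler_sum// => i _.
  have -> : avg (fun w => f w * X i w) = avg (fun w => s w * X i w) + avg (fun w => dd w * X i w).
    by rewrite -avgD; apply: eq_avg => w; rewrite /s /dd; field.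
  have -> : avg (fun w => g w * X i w) = avg (fun w => s w * X i w) - avg (fun w => dd w * X i w).
    by rewrite -avgB; apply: eq_avg => w; rewrite /s /dd; field.
  by rewrite mulrC -subr_sqr gerBl sqr_ge0.
have fg : avg (fun w => f w * g w) = 2 * p - 1.
  rewrite -[X in _ - X](avg_cst t0) -avgZ -avgB; apply: eq_avg => w.
  by rewrite /s; case: (f1 w) (g1 w) => [] -> [] ->; field.
have e_gt0 : 0 < eta by move: n1; clear; lra.
set G := avg (fun w => Num.max 0 (`|L w| - eta)).
pose eB := 2 * (48 * b ^+ 2 / eta ^+ 4).
pose Z := 1 - 2 * p + eB + 4 / eta * (G - (r - eta * p)).
have noise bb : - avg (fun w => f w * g (tau bb w)) <= Z.
  by rewrite /Z rL; apply: (avg_noise_le t0) (tauK bb) e_gt0 f1 g1 (hM bb) (fun=> erefl).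
have noiseZ : - (b * \sum_bb avg (fun w => f w * g (tau bb w))) <= Z.
  rewrite -mulrN -sumrN.
  apply: (@le_trans _ _ (b * \sum_(bb < B) Z)).
    by rewrite ler_pM2l// ler_sum.
  by rewrite sumr_const card_ord -[Z *+ B]mulr_natl mulrA mulVf ?mul1r// pnatr_eq0 -lt0n.
set r0 := 2 * gauss eta.
have r00 : 0 < r0 by rewrite mulr_gt0// gauss_gt0.
have aE' : 4 * gauss eta ^+ 2 = r0 ^+ 2 by rewrite /r0; ring.
have PhiE : 2 * Phi (- eta) = (1 + r0 ^+ 2) / 2 by move: aE aE'; clear; lra.
have NE : 2 * pos_mean (- eta) = r0 - eta * ((1 + r0 ^+ 2) / 2).
  by rewrite -PhiE /pos_mean gaussN /r0; ring.
have /andP[g01 g02] := gauss0_bounds R.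
have a12 : 56 / 100 <= r0 ^+ 2 <= 673 / 1000.
  have h1 := gauss_ge eta; have h2 := gauss_le0 eta; have h3 := gauss_gt0 eta.
  have h4 : 0 < gauss (0 : R) by exact: gauss_gt0.
  have h5 : 955 / 1000 <= 1 - eta ^+ 2 / 2 by move: n1 n2; clear; nra.
  have h6 : 955 / 1000 * (395 / 1000) <= gauss eta by move: h1 h4 h5 g01; clear; nra.
  rewrite -aE'; move: h6 h2 g02; clear; nra.
set q := p - (1 + r0 ^+ 2) / 2.
(* Moving the threshold to [eta - q] contributes [- q ^+ 2], and the curvature of [pos_mean] at most
   [gauss 0 * q ^+ 2]. *)
set k := 1 - gauss (0 : R).
have rq : r <= r0 + eta * q - k * q ^+ 2 + d.
  (* The best threshold for a given mean [p] of [s^2] is within O(q^2) of [eta - q]. *)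
  have h1 : r <= (eta - q) * p + avg (fun w => Num.max 0 (`|L w| - (eta - q))).
    rewrite rL -avgZ -avgD; apply: le_avg => w; exact: choice_le.
  have h2 := hG (eta - q).
  have h3 := pos_mean_quadratic (- (eta - q)) (- eta).
  have h4 : - (eta - q) - - eta = q by ring.
  rewrite h4 in h3.
  have -> : r0 + eta * q - k * q ^+ 2 + d =
     (eta - q) * p + (2 * pos_mean (- eta) + 2 * Phi (- eta) * q + gauss 0 * q ^+ 2) + d.
    by rewrite NE PhiE /k (_ : p = q + (1 + r0 ^+ 2) / 2); [field|rewrite /q; ring].
  move: h1 h2 h3; rewrite -/(L _) /L; clear; lra.
have k12 : 59 / 100 <= k <= 605 / 1000 by rewrite /k; move: g01 g02; clear; lra.
have b10 : 0 < b <= 1 / 10 by rewrite b0; move: Bb; clear; lra.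
have e10 : 0 < e <= b / 1000 by rewrite e0.
(* As [eta >= 1 / 5], [eB] is at most [60000 * b ^+ 2]; the bound [b <= 10 ^- 6] makes this small
   compared with [b]. *)
have eB0 : 0 <= eB <= b / 10.
  have e4 : 1 / 625 <= eta ^+ 4.
    have -> : 1 / 625 = (1 / 5) ^+ 4 :> R by field.
    by rewrite lerXn2r ?nnegrE//; move: n1; clear; lra.
  have e4' : 0 < eta ^+ 4 by rewrite exprn_gt0.
  rewrite /eB mulrA; apply/andP; split.
    apply: divr_ge0; last exact: ltW.
    by apply: mulr_ge0 => //; apply: mulr_ge0 => //; exact: sqr_ge0.
  rewrite ler_pdivrMr//.
  apply: (@le_trans _ _ (b / 10 * (1 / 625))); last by rewrite ler_wpM2l// ltW// divr_gt0.
  by move: b0 Bb; clear; nra.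
have hn : 4 / eta * eta = 4 by rewrite divfK// gt_eqF.
have d01 : 0 <= d <= 1 / 10 by rewrite d0.
have n12 : 1 / 5 <= eta <= 3 / 10 by rewrite n1.
have main := perturbed_optimum n12 r00 a12 k12 b10 e10 eB0 hn d01 r_ge0 p01 rq.
rewrite aE'; apply: le_trans main.
rewrite fg -/p -lerBlDr.
have s0 : 0 <= 1 + e * (1 - 2 * b) by case/andP: b10 => _; move: e0; clear; nra.
have quad' := ler_wpM2l s0 quad.
have noise' := ler_wpM2l (ltW e0) noiseZ.
have G1 : G <= r0 - eta * ((1 + r0 ^+ 2) / 2) + d by rewrite -NE; exact: hG.
have G2 : e * (4 / eta * (G - (r - eta * p))) <=
   e * (4 / eta * (r0 - eta * ((1 + r0 ^+ 2) / 2) + d - (r - eta * p))).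
  rewrite ler_wpM2l ?(ltW e0)// ler_wpM2l ?divr_ge0 ?(ltW e_gt0)//.
  by move: G1; clear; lra.
move: quad' noise' G2; rewrite /Z.
set A := \sum_i _; set S := b * _; set h := 4 / eta; clear; move=> quad' noise' G2.
lra.
Qed.

(** * The perturbed form on unit vectors *)

(** A minorant polynomial in [x ^+ 2]: it bounds the mean of a norm from below by its second and
    fourth moments. *)
Lemma sqrt_ge_quadratic (R : realType) (x : R) : 0 <= x ->
  1 + (x ^+ 2 - 1) / 2 - (x ^+ 2 - 1) ^+ 2 / 2 <= x.
Proof.
move=> x0; rewrite -subr_ge0.
have -> : x - (1 + (x ^+ 2 - 1) / 2 - (x ^+ 2 - 1) ^+ 2 / 2) =
  (x - 1) ^+ 2 * (x * (x + 2)) / 2 by field.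
by rewrite divr_ge0// mulr_ge0 ?sqr_ge0// mulr_ge0// addr_ge0.
Qed.

Lemma mul_le_weighted (R : realType) (x y th : R) : 0 < th ->
  x * y <= th / 2 * x ^+ 2 + th^-1 / 2 * y ^+ 2.
Proof.
move=> t0; rewrite -subr_ge0.
have -> : th / 2 * x ^+ 2 + th^-1 / 2 * y ^+ 2 - x * y = (th * x - y) ^+ 2 / (2 * th).
  by field; rewrite gt_eqF.
by rewrite divr_ge0 ?sqr_ge0// mulr_ge0// ltW.
Qed.

(** The witness is [X / |X|]. Its distance to the linear map [X / sqrt k] is small on average
    because [|X| ^+ 2 / k] has variance at most [4 / k]; on linear maps the noise acts as
    [1 - 2 / B], which cancels the added multiple of the projection. *)
Lemma vector_value_ge (R : realType) (T I : finType) (i0 : I) (t0 : T) (B : nat)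
    (X : I -> T -> R) (tau : 'I_B -> T -> T) (lam e th : R) :
  (0 < B)%N -> 0 <= e <= 1 -> 0 < th ->
  (forall b, involutive (tau b)) ->
  (forall i, avg (fun w => X i w ^+ 2) = 1) ->
  (forall b i, avg (fun w => X i w * X i (tau b w)) = 1 - 2 * B%:R^-1) ->
  avg (fun w => (\sum_i X i w ^+ 2) ^+ 2) <= #|I|%:R ^+ 2 + 4 * #|I|%:R ->
  exists2 F : I -> T -> R, forall w, \sum_i F i w ^+ 2 = 1 &
  1 - lam - (8 / #|I|%:R + th + 4 / (#|I|%:R * th)) <=
  (1 + e * (1 - 2 * B%:R^-1)) * (\sum_i \sum_l avg (fun w => F l w * X i w) ^+ 2) -
    lam * avg (fun w => \sum_i F i w ^+ 2) -
    e * (B%:R^-1 * \sum_b avg (fun w => \sum_i F i w * F i (tau b w))).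
Proof.
move=> B0 /andP[e0 e1] th0 tauK X2 Xtau X4.
set k := #|I|%:R in X4 *.
have k0 : 0 < k by rewrite ltr0n; apply/card_gt0P; exists i0.
have kn : k != 0 by rewrite gt_eqF.
set b := B%:R^-1 in Xtau *.
have b0 : 0 < b by rewrite invr_gt0 ltr0n.
have b1 : b <= 1 by rewrite invf_le1 ?ltr0n// ler1n.
have sk0 : 0 < Num.sqrt k by rewrite sqrtr_gt0.
have sk2 : Num.sqrt k ^+ 2 = k by rewrite sqr_sqrtr// ltW.
pose rho w := Num.sqrt (\sum_i X i w ^+ 2) / Num.sqrt k.
pose Y i w := X i w / Num.sqrt k.
(* Where [X] vanishes a basis vector is taken, so that [F] has norm 1 everywhere. *)
pose F i w := if rho w == 0 then (i == i0)%:R else Y i w / rho w.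
have rho0 w : 0 <= rho w by rewrite divr_ge0 ?sqrtr_ge0.
have X0 w : 0 <= \sum_i X i w ^+ 2 by apply: sumr_ge0 => i _; exact: sqr_ge0.
have rho2 w : rho w ^+ 2 = k^-1 * \sum_i X i w ^+ 2.
  by rewrite /rho expr_div_n sk2 sqr_sqrtr// mulrC.
have Y2 w : \sum_i Y i w ^+ 2 = rho w ^+ 2.
  rewrite rho2 mulr_sumr; apply: eq_bigr => i _.
  by rewrite /Y expr_div_n sk2 mulrC.
have F2 w : \sum_i F i w ^+ 2 = 1.
  rewrite /F; case: eqP => [_|/eqP r0].
    rewrite (bigD1 i0)//= eqxx expr1n big1 ?addr0// => i /negbTE ->.
    by rewrite expr0n.
  under eq_bigr do rewrite expr_div_n.
  by rewrite -mulr_suml Y2 divff// expf_neq0.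
have FY w : \sum_i F i w * Y i w = rho w.
  rewrite /F; case: eqP => [r0|/eqP r0].
    have Y0 i : Y i w = 0.
      have /eqP : \sum_i Y i w ^+ 2 = 0 by rewrite Y2 r0 expr0n.
      rewrite psumr_eq0 => [|j _]; last exact: sqr_ge0.
      by move=> /allP /(_ i); rewrite mem_index_enum sqrf_eq0 => /(_ isT) /eqP.
    by rewrite big1// => i _; rewrite Y0 mulr0.
  under eq_bigr do rewrite mulrAC -expr2.
  by rewrite -mulr_suml Y2 expr2 mulfK.
have arho2 : avg (fun w => rho w ^+ 2) = 1.
  rewrite (eq_avg rho2) avgZ avg_sum (eq_bigr (fun=> 1)); last by move=> i _; exact: X2.
  by rewrite sumr_const -[1 *+ _]/(k) mulVf.
have arho : 1 - 2 / k <= avg rho.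
  have H : avg (fun w => (rho w ^+ 2 - 1) ^+ 2) <= 4 / k.
    have -> : avg (fun w => (rho w ^+ 2 - 1) ^+ 2) =
        k^-1 ^+ 2 * avg (fun w => (\sum_i X i w ^+ 2) ^+ 2) - 1.
      have -> : avg (fun w => (rho w ^+ 2 - 1) ^+ 2) =
          avg (fun w => k^-1 ^+ 2 * (\sum_i X i w ^+ 2) ^+ 2 - 2 * rho w ^+ 2 + 1).
        by apply: eq_avg => w; rewrite rho2; ring.
      by rewrite avgD avgB !avgZ arho2 (avg_cst t0); ring.
    have k2 : 0 <= k^-1 ^+ 2 by exact: sqr_ge0.
    have := ler_wpM2l k2 X4.
    have -> : k^-1 ^+ 2 * (k ^+ 2 + 4 * k) = 1 + 4 / k by field.
    by clear; lra.
  apply: (@le_trans _ _ (avg (fun w => 1 + (rho w ^+ 2 - 1) / 2 - (rho w ^+ 2 - 1) ^+ 2 / 2))).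
    have -> : avg (fun w => 1 + (rho w ^+ 2 - 1) / 2 - (rho w ^+ 2 - 1) ^+ 2 / 2) =
       avg (fun w => 1 / 2 + 1 / 2 * rho w ^+ 2 - 1 / 2 * (rho w ^+ 2 - 1) ^+ 2).
      by apply: eq_avg => w; field.
    rewrite avgB avgD !avgZ arho2 (avg_cst t0); move: H; clear; lra.
  by apply: le_avg => w; exact: sqrt_ge_quadratic.
exists F => //.
(* Only the diagonal terms are kept, and each square is linearized by [x ^+ 2 >= 2 * x * y - y ^+ 2]
   at [y = 1 / sqrt k]. *)
have quad : 1 - 4 / k <= \sum_i \sum_l avg (fun w => F l w * X i w) ^+ 2.
  apply: (@le_trans _ _ (\sum_i avg (fun w => F i w * X i w) ^+ 2)); last first.
    apply: ler_sum => i _; rewrite (bigD1 i)//= lerDl.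
    by apply: sumr_ge0 => l _; exact: sqr_ge0.
  apply: (@le_trans _ _ (\sum_i (2 * avg (fun w => F i w * Y i w) - k^-1))).
    rewrite sumrB -mulr_sumr -avg_sum (eq_avg FY) sumr_const -[k^-1 *+ _]mulr_natl divff//.
    by move: arho; clear; lra.
  apply: ler_sum => i _.
  have -> : avg (fun w => F i w * Y i w) = (Num.sqrt k)^-1 * avg (fun w => F i w * X i w).
    by rewrite -avgZ; apply: eq_avg => w; rewrite /Y; field; rewrite gt_eqF.
  rewrite -{2}sk2 -exprVn -subr_ge0; set x := avg _; set y := (Num.sqrt k)^-1.
  have -> : x ^+ 2 - (2 * (y * x) - y ^+ 2) = (x - y) ^+ 2 by ring.
  exact: sqr_ge0.
have noise bb : avg (fun w => \sum_i F i w * F i (tau bb w)) <=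
    1 - 2 * b + th + 4 / (k * th).
  pose G i w := F i w - Y i w.
  have G2 w : \sum_i G i w ^+ 2 = 1 - 2 * rho w + rho w ^+ 2.
    rewrite -Y2 -FY -[X in _ = X - _ + _](F2 w) mulr_sumr -sumrB -big_split /=.
    by apply: eq_bigr => i _; rewrite /G; ring.
  have aG2 : avg (fun w => \sum_i G i w ^+ 2) <= 4 / k.
    rewrite (eq_avg G2) avgD avgB avgZ arho2 (avg_cst t0).
    by move: arho; clear; lra.
  have tI := inv_inj (tauK bb).
  have aY : avg (fun w => \sum_i Y i w * Y i (tau bb w)) = 1 - 2 * b.
    rewrite avg_sum (eq_bigr (fun=> k^-1 * (1 - 2 * b))) => [|i _].
      by rewrite sumr_const -[_ *+ _]mulr_natl mulrA divff// mul1r.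
    rewrite -(Xtau bb i) -avgZ; apply: eq_avg => w.
    rewrite /Y (_ : k^-1 = (Num.sqrt k)^-1 ^+ 2); last by rewrite exprVn sk2.
    by field; rewrite gt_eqF.
  (* Writing [F = Y + G] at both points gives [F F' = Y Y' + Y' G + F G']; the two terms with the
     small factor [G] are bounded by weighted squares. *)
  have pw w : \sum_i F i w * F i (tau bb w) <=
      \sum_i Y i w * Y i (tau bb w) +
      (th / 2 * rho (tau bb w) ^+ 2 + th^-1 / 2 * \sum_i G i w ^+ 2) +
      (th / 2 * \sum_i F i w ^+ 2 + th^-1 / 2 * \sum_i G i (tau bb w) ^+ 2).
    rewrite -Y2 !mulr_sumr -!big_split /=; apply: ler_sum => i _.
    have h1 := mul_le_weighted (Y i (tau bb w)) (G i w) th0.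
    have h2 := mul_le_weighted (F i w) (G i (tau bb w)) th0.
    have -> : F i w * F i (tau bb w) = Y i w * Y i (tau bb w) +
       Y i (tau bb w) * G i w + F i w * G i (tau bb w) by rewrite /G; ring.
    by move: h1 h2; clear; lra.
  apply: (le_trans (le_avg pw)).
  have e1' : avg (fun w => rho (tau bb w) ^+ 2) = 1.
    by rewrite -arho2; exact: (avg_inj (fun w => rho w ^+ 2) tI).
  have e2' : avg (fun w => \sum_i G i (tau bb w) ^+ 2) = avg (fun w => \sum_i G i w ^+ 2).
    exact: (avg_inj (fun w => \sum_i G i w ^+ 2) tI).
  rewrite !avgD !avgZ aY e1' e2' (eq_avg F2) (avg_cst t0).
  have ti : 0 <= th^-1 by rewrite invr_ge0 ltW.
  have := ler_wpM2l ti aG2.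
  have -> : th^-1 * (4 / k) = 4 / (k * th) by field; rewrite !gt_eqF.
  by clear; lra.
set W := 1 - 2 * b + th + 4 / (k * th) in noise.
have noiseW : b * \sum_bb avg (fun w => \sum_i F i w * F i (tau bb w)) <= W.
  apply: (@le_trans _ _ (b * \sum_(bb < B) W)); first by rewrite ler_pM2l// ler_sum.
  by rewrite sumr_const card_ord -[W *+ B]mulr_natl mulrA mulVf ?mul1r// pnatr_eq0 -lt0n.
rewrite (eq_avg F2) (avg_cst t0) mulr1.
set A := 1 + e * (1 - 2 * b).
have A0 : 0 <= A by rewrite /A; move: e0 e1 b0 b1; clear; nra.
have A2 : A <= 2 by rewrite /A; move: e0 e1 b0 b1; clear; nra.
have h1 := ler_wpM2l A0 quad.
have h2 := ler_wpM2l e0 noiseW.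
have ki : 0 <= k^-1 by rewrite invr_ge0 ltW.
have h3 : A * (4 / k) <= 8 / k.
  have -> : A * (4 / k) = (A * 4) * k^-1 by ring.
  by rewrite ler_wpM2r//; move: A2; clear; lra.
have h4 : e * (th + 4 / (k * th)) <= th + 4 / (k * th).
  by rewrite ler_piMl// addr_ge0 ?(ltW th0)// divr_ge0// mulr_ge0// ltW.
have h5 : e * W = A - 1 + e * (th + 4 / (k * th)) by rewrite /W /A; ring.
move: h1 h2 h3 h4 h5; clear.
set Q := \sum_i _; set P := b * _; lra.
Qed.

(** * Block sums and block flips *)

Lemma signed_sum_sub_flip (R : realType) (J : finType) (c : J -> R) s (A : pred J) w :
  signed_sum c s w - signed_sum c s (flip A w) = 2 * signed_sum c [seq j <- s | A j] w.
Proof.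
rewrite /signed_sum big_filter -sumrB mulr_sumr [RHS]big_mkcond /=; apply: eq_bigr => j _.
by rewrite coord_sign_flip; case: (A j); [ring|rewrite subrr].
Qed.

(** A sign is located by its Gaussian coordinate, its block and its place in the block. *)
Definition block_index (k B M : nat) : finType := ('I_k * ('I_B * 'I_M))%type.

Definition block_coef (R : realType) (k B M : nat) (u : 'I_k -> R)
  (j : block_index k B M) : R := u j.1 / Num.sqrt (B * M)%:R.

Definition block_sum (R : realType) (k B M : nat) (i : 'I_k)
    (w : {ffun block_index k B M -> bool}) : R :=
  signed_sum (block_coef (fun l => (l == i)%:R)) (index_enum (block_index k B M)) w.

(** The block is flipped in all [k] coordinates at once, so every unit linear form is affected in
    the same proportion. *)
Definition block_flip (k B M : nat) (b : 'I_B) :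
    {ffun block_index k B M -> bool} -> {ffun block_index k B M -> bool} :=
  flip (fun j => j.2.1 == b).

Lemma block_sum_lin (R : realType) (k B M : nat) (u : 'I_k -> R) w :
  \sum_i u i * @block_sum R k B M i w =
  signed_sum (block_coef u) (index_enum (block_index k B M)) w.
Proof.
rewrite /block_sum /signed_sum; under eq_bigr do rewrite mulr_sumr.
rewrite exchange_big /=; apply: eq_bigr => j _.
rewrite (bigD1 j.1)//= big1 => [|i /negbTE ij].
  by rewrite addr0 /block_coef eqxx /= mul1r !mulrA.
by rewrite /block_coef eq_sym ij /= !mul0r mulr0.
Qed.

Lemma sum_block_coef (R : realType) (k B M : nat) (u : 'I_k -> R) :
  (0 < B)%N -> (0 < M)%N ->
  \sum_(j : block_index k B M) block_coef u j ^+ 2 = \sum_i u i ^+ 2.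
Proof.
move=> B0 M0; rewrite /block_coef.
rewrite -(pair_bigA _ (fun i (_ : 'I_B * 'I_M) => (u i / Num.sqrt (B * M)%:R) ^+ 2)) /=.
apply: eq_bigr => i _; rewrite sumr_const card_prod !card_ord.
rewrite -[_ *+ (B * M)]mulr_natl expr_div_n sqr_sqrtr ?ler0n// mulrC divfK//.
by rewrite pnatr_eq0 muln_eq0 negb_or -!lt0n B0.
Qed.

Lemma sum_block_coef_flip (R : realType) (k B M : nat) (u : 'I_k -> R) (b : 'I_B) :
  (0 < B)%N -> (0 < M)%N ->
  \sum_(j : block_index k B M | j.2.1 == b) block_coef u j ^+ 2 =
  B%:R^-1 * \sum_i u i ^+ 2.
Proof.
move=> B0 M0; rewrite /block_coef big_mkcond /=.
rewrite -(pair_bigA _ (fun i (p : 'I_B * 'I_M) =>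
  if p.1 == b then (u i / Num.sqrt (B * M)%:R) ^+ 2 else 0)) /= mulr_sumr.
apply: eq_bigr => i _.
rewrite -(pair_bigA _ (fun a (_ : 'I_M) =>
  if a == b then (u i / Num.sqrt (B * M)%:R) ^+ 2 else 0)) /=.
rewrite (bigD1 b)//= eqxx [X in _ + X]big1 ?addr0 => [|a /negbTE ->]; last first.
  by rewrite big1.
rewrite sumr_const card_ord -[_ *+ M]mulr_natl expr_div_n sqr_sqrtr ?ler0n// natrM.
by field; rewrite !pnatr_eq0 -!lt0n B0.
Qed.

Lemma block_flipK (k B M : nat) (b : 'I_B) : involutive (@block_flip k B M b).
Proof. exact: flipK. Qed.

Lemma sum_delta_sqr (R : realType) (k : nat) (i : 'I_k) :
  \sum_(l < k) ((l == i)%:R : R) ^+ 2 = 1.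
Proof.
rewrite (bigD1 i)//= eqxx expr1n big1 ?addr0// => l /negbTE ->.
by rewrite expr0n.
Qed.

Lemma avg_block_sum_sqr (R : realType) (k B M : nat) (i : 'I_k) :
  (0 < B)%N -> (0 < M)%N -> avg (fun w => @block_sum R k B M i w ^+ 2) = 1.
Proof.
by move=> B0 M0; rewrite avg_signed_sum_sqr ?index_enum_uniq// sum_block_coef// sum_delta_sqr.
Qed.

(** Polarization: the difference of the two sums is twice the part in block [b], of second moment
    [1 / B]. *)
Lemma avg_block_sum_flip (R : realType) (k B M : nat) (i : 'I_k) (b : 'I_B) :
  (0 < B)%N -> (0 < M)%N ->
  avg (fun w => @block_sum R k B M i w * block_sum R i (block_flip b w)) = 1 - 2 * B%:R^-1.
Proof.
move=> B0 M0.
have H : avg (fun w => (@block_sum R k B M i w - block_sum R i (block_flip b w)) ^+ 2) =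
    4 * B%:R^-1.
  rewrite /block_sum /block_flip.
  under eq_avg do rewrite signed_sum_sub_flip exprMn.
  rewrite avgZ avg_signed_sum_sqr ?filter_uniq ?index_enum_uniq// big_filter sum_block_coef_flip//.
  by rewrite sum_delta_sqr; ring.
have e1 : avg (fun w => @block_sum R k B M i (block_flip b w) ^+ 2) = 1.
  rewrite -(avg_block_sum_sqr R i B0 M0).
  exact: (avg_inj (fun w => block_sum R i w ^+ 2) (inv_inj (@block_flipK k B M b))).
have : avg (fun w => (@block_sum R k B M i w - block_sum R i (block_flip b w)) ^+ 2) =
   avg (fun w => @block_sum R k B M i w ^+ 2 + block_sum R i (block_flip b w) ^+ 2 -
     2 * (block_sum R i w * block_sum R i (block_flip b w))).
  by apply: eq_avg => w; ring.
rewrite H avgB avgD avgZ e1 avg_block_sum_sqr//; lra.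
Qed.

(** The vectors attached to the signs are basis vectors divided by [N], each repeated [N ^+ 2]
    times; the inner product condition of [avg_sqnorm_sqr] holds with equality. *)
Lemma avg_block_sum_norm4 (R : realType) (k B M : nat) :
  (0 < B)%N -> (0 < M)%N ->
  avg (fun w => (\sum_i @block_sum R k B M i w ^+ 2) ^+ 2) <= k%:R ^+ 2 + 4 * k%:R.
Proof.
move=> B0 M0; set N := Num.sqrt ((B * M)%:R : R).
have N2 : N ^+ 2 = (B * M)%:R by rewrite sqr_sqrtr.
have N0 : (B * M)%:R != 0 :> R by rewrite pnatr_eq0 muln_eq0 negb_or -!lt0n B0.
pose v (j : block_index k B M) (i : 'I_k) : R := (j.1 == i)%:R / N.
have vv j l : \sum_i v j i * v l i = (j.1 == l.1)%:R / (B * M)%:R.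
  rewrite (bigD1 j.1)//= big1 => [|i /negbTE ij]; last by rewrite /v eq_sym ij !mul0r.
  by rewrite addr0 /v eqxx /= mul1r (eq_sym l.1) mulrCA -invfM -expr2 N2.
have v2 j : \sum_i v j i ^+ 2 = (B * M)%:R^-1.
  by under eq_bigr do rewrite expr2; rewrite vv eqxx mul1r.
have vs : \sum_j \sum_i v j i ^+ 2 = k%:R.
  rewrite (eq_bigr (fun=> (B * M)%:R^-1)) => [|j _]; last exact: v2.
  by rewrite sumr_const !card_prod !card_ord -[_ *+ _]mulr_natl natrM mulfK.
rewrite -vs; apply: avg_sqnorm_sqr; first exact: index_enum_uniq.
move=> j; rewrite v2.
have -> : \sum_l (\sum_i v j i * v l i) ^+ 2 =
    \sum_(l : block_index k B M) block_coef (fun a => (a == j.1)%:R / N) l ^+ 2.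
  by apply: eq_bigr => l _; rewrite vv /block_coef (eq_sym j.1) -/N -mulrA -invfM -expr2 N2.
rewrite sum_block_coef//; under eq_bigr do rewrite expr_div_n.
by rewrite -mulr_suml sum_delta_sqr mul1r N2.
Qed.

Lemma block_sum_threshold_le (R : realType) (k B M : nat) (u : 'I_k -> R) (v t : R) :
  (0 < B)%N -> (0 < M)%N -> 0 < v -> \sum_i u i ^+ 2 = 1 ->
  avg (fun w => Num.max 0 (`|\sum_i u i * @block_sum R k B M i w| - t)) <=
  2 * (pos_mean (- t) + v + (Num.sqrt (B * M)%:R)^-1 / v).
Proof.
move=> B0 M0 v0 u1; under eq_avg do rewrite block_sum_lin.
apply: avg_threshold_le; rewrite ?index_enum_uniq ?sum_block_coef// => j.
have N0 : 0 <= (Num.sqrt (B * M)%:R)^-1 :> R by rewrite invr_ge0 sqrtr_ge0.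
rewrite normrM (ger0_norm N0) ler_piMl//.
rewrite -(@ler_sqr R)// ?nnegrE// expr1n real_normK ?num_real// -u1 (bigD1 j.1)//= lerDl.
by apply: sumr_ge0 => i _; exact: sqr_ge0.
Qed.

(** The constant is [2 ^ 4 * 3]: the difference is twice a sign sum of variance [1 / B]. *)
Lemma avg_block_flip_pow4 (R : realType) (k B M : nat) (u : 'I_k -> R) (b : 'I_B) :
  (0 < B)%N -> (0 < M)%N -> \sum_i u i ^+ 2 = 1 ->
  avg (fun w => (\sum_i u i * @block_sum R k B M i w -
                 \sum_i u i * block_sum R i (block_flip b w)) ^+ 4) <=
  48 * B%:R^-1 ^+ 2.
Proof.
move=> B0 M0 u1; under eq_avg do rewrite !block_sum_lin signed_sum_sub_flip exprMn.
rewrite avgZ.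
have := avg_signed_sum_pow4 (block_coef u)
  (filter_uniq (fun j : block_index k B M => j.2.1 == b) (index_enum_uniq _)).
rewrite big_filter sum_block_coef_flip// u1 mulr1; lra.
Qed.

(** * From the kernel to matrices *)

Lemma dotprod_le (R : realType) (d : nat) (x y : 'rV[R]_d) :
  unit_sphere x -> unit_sphere y -> `|dotprod x y| <= 1.
Proof.
have nrm (z : 'rV[R]_d) : unit_sphere z -> \sum_k z ord0 k ^+ 2 = 1.
  move=> z1; have z0 : 0 <= dotprod z z.
    by apply: sumr_ge0 => k _; rewrite -expr2 sqr_ge0.
  transitivity (dotprod z z); first by apply: eq_bigr => k _; rewrite expr2.
  by rewrite -(sqr_sqrtr z0) -/(euclidean_norm z) z1 expr1n.
move=> /nrm x1 /nrm y1.
have H : \sum_k `|x ord0 k * y ord0 k| <= 1.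
  have -> : 1 = \sum_k (x ord0 k ^+ 2 / 2 + y ord0 k ^+ 2 / 2) :> R.
    by rewrite big_split /= -!mulr_suml x1 y1; field.
  apply: ler_sum => k _; rewrite normrM -(real_normK (num_real (x ord0 k))).
  rewrite -(real_normK (num_real (y ord0 k))).
  have := sqr_ge0 (`|x ord0 k| - `|y ord0 k|); lra.
by apply: le_trans H; exact: ler_norm_sum.
Qed.

(** Transfers the inequality to kernels on a finite type. The same vectors serve on both sides,
    padded with zeros up to the dimension [n + n] imposed by [max_spheres], whence the condition on
    [k]. *)
Lemma grothendieck_bound_finite (R : realType) (T : finType) (t0 : T) (k : nat)
    (a : T -> T -> R) (F : 'I_k -> T -> R) (K V : R) :
  0 <= K -> grothendieck_bound K -> (k <= #|T| + #|T|)%N ->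
  (forall t, \sum_i F i t ^+ 2 = 1) ->
  (forall f g : T -> R, (forall t, f t = 1 \/ f t = -1) ->
     (forall t, g t = 1 \/ g t = -1) -> \sum_t \sum_s a t s * f t * g s <= V) ->
  \sum_t \sum_s a t s * (\sum_i F i t * F i s) <= K * V.
Proof.
move=> K0 KG kT F1 aV; set n := #|T|.
have n0 : (0 < n)%N by apply/card_gt0P; exists t0.
pose A : 'M[R]_(n, n) := \matrix_(i, j) a (enum_val i) (enum_val j).
pose G t (l : nat) : R := if insub l is Some i then F i t else 0.
pose x (i : 'I_n) : 'rV[R]_(n + n) := \row_l G (enum_val i) l.
have sumE (h : T -> R) : \sum_t h t = \sum_(i < n) h (enum_val i).
  by rewrite (reindex _ (onW_bij _ (@enum_val_bij T))).
have xE i j : dotprod (x i) (x j) = \sum_l F l (enum_val i) * F l (enum_val j).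
  rewrite /dotprod; under eq_bigr do rewrite !mxE.
  transitivity (\sum_(l < k) G (enum_val i) l * G (enum_val j) l).
    rewrite (@big_ord_widen _ _ _ k (n + n) (fun l => G (enum_val i) l * G (enum_val j) l))//.
    rewrite [RHS]big_mkcond /=; apply: eq_bigr => l _; case: ifP => // /negbT lk.
    by rewrite /G insubN// mul0r.
  by apply: eq_bigr => l _; rewrite /G valK.
have x1 i : unit_sphere (x i).
  rewrite /unit_sphere /= /euclidean_norm xE.
  by under eq_bigr do rewrite -expr2; rewrite F1 sqrtr1.
have le1 : \sum_t \sum_s a t s * (\sum_i F i t * F i s) <= max_spheres A.
  apply: ub_le_sup.
    exists (\sum_(i < n) \sum_(j < n) `|A i j|) => _ [y /= y1 [z /= z1 <-]].
    apply: ler_sum => i _; apply: ler_sum => j _.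
    apply: (le_trans (ler_norm _)); rewrite normrM ler_piMr//.
    exact: dotprod_le (y1 i) (z1 j).
  exists x => //; exists x => //; rewrite sumE; apply: eq_bigr => i _.
  by rewrite sumE; apply: eq_bigr => j _; rewrite mxE xE.
apply: (le_trans le1); apply: (le_trans (KG n n n0 n0 A)).
rewrite ler_wpM2l//; apply: ge_sup.
  by exists (\sum_(i < n) \sum_(j < n) A i j * 1 * 1), (fun=> 1); [left|exists (fun=> 1) => //; left].
move=> _ [eps /= eps1 [del /= del1 <-]].
have rk (t : T) : enum_val (enum_rank t) = t by exact: enum_rankK.
have := aV (fun t => eps (enum_rank t)) (fun t => del (enum_rank t))
  (fun t => eps1 _) (fun t => del1 _).
rewrite sumE (eq_bigr _ (fun i _ => sumE _)).
apply: le_trans; rewrite le_eqVlt; apply/orP; left; apply/eqP.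
by apply: eq_bigr => i _; apply: eq_bigr => j _; rewrite mxE !enum_valK.
Qed.

(** The squared weight splits the double sum into a product of averages, while the deltas at [t] and
    [tau b t] collapse one sum and leave a single average. *)
Lemma kernel_formE (R : realType) (T I : finType) (B : nat) (X : I -> T -> R)
    (tau : 'I_B -> T -> T) (A lam c : R) (f g : T -> R) :
  \sum_t \sum_s (#|T|%:R^-1 ^+ 2 * (A * \sum_i X i t * X i s) -
      #|T|%:R^-1 * (lam * (s == t)%:R) -
      #|T|%:R^-1 * (c * \sum_b (s == tau b t)%:R)) * f t * g s =
  A * (\sum_i avg (fun t => f t * X i t) * avg (fun t => g t * X i t)) -
  lam * avg (fun t => f t * g t) - c * \sum_b avg (fun t => f t * g (tau b t)).
Proof.
set P := #|T|%:R^-1.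
have delta (h : T -> R) u : \sum_s (s == u)%:R * h s = h u.
  rewrite (bigD1 u)//= eqxx mul1r big1 ?addr0// => s /negbTE ->.
  by rewrite mul0r.
have e1 : A * (\sum_i avg (fun t => f t * X i t) * avg (fun t => g t * X i t)) =
    \sum_t \sum_s P ^+ 2 * (A * \sum_i X i t * X i s) * f t * g s.
  transitivity (\sum_i \sum_t \sum_s P ^+ 2 * (A * (X i t * X i s)) * f t * g s).
    rewrite mulr_sumr; apply: eq_bigr => i _.
    rewrite /avg -/P mulrACA mulr_suml 2!mulr_sumr; apply: eq_bigr => t _.
    by rewrite 3!mulr_sumr; apply: eq_bigr => s _; ring.
  rewrite exchange_big /=; apply: eq_bigr => t _.
  rewrite exchange_big /=; apply: eq_bigr => s _.
  by rewrite !mulr_sumr !mulr_suml.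
have e2 : lam * avg (fun t => f t * g t) =
    \sum_t \sum_s P * (lam * (s == t)%:R) * f t * g s.
  rewrite /avg -/P 2!mulr_sumr; apply: eq_bigr => t _.
  rewrite -(delta g t) !mulr_sumr; apply: eq_bigr => s _; ring.
have e3 : c * \sum_b avg (fun t => f t * g (tau b t)) =
    \sum_t \sum_s P * (c * \sum_b (s == tau b t)%:R) * f t * g s.
  rewrite /avg -/P -mulr_sumr exchange_big /= 2!mulr_sumr; apply: eq_bigr => t _.
  transitivity (\sum_b \sum_s P * (c * (s == tau b t)%:R) * f t * g s).
    rewrite !mulr_sumr; apply: eq_bigr => b _.
    rewrite -(delta g (tau b t)) !mulr_sumr; apply: eq_bigr => s _; ring.
  rewrite exchange_big /=; apply: eq_bigr => s _.
  by rewrite !mulr_sumr !mulr_suml.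
rewrite e1 e2 e3 -!sumrB; apply: eq_bigr => t _.
by rewrite -!sumrB; apply: eq_bigr => s _; ring.
Qed.

(** * Assembling the lower bound *)

(** Both values of one kernel are compared, with all discretization errors absorbed in [d]. Only [k]
    and [M] depend on [d], so the gain [e / B] survives when [d] tends to 0. *)
Lemma grothendieck_bound_perturbed (R : realType) (K eta e d : R) (B : nat) :
  0 < K -> grothendieck_bound K ->
  (0 < B)%N -> B%:R^-1 <= 10 ^- 6 :> R -> 0 < e <= B%:R^-1 / 1000 -> 0 < d <= 1 / 10 ->
  1 / 5 <= eta <= 3 / 10 -> 4 * gauss eta ^+ 2 = 4 * Phi (- eta) - 1 ->
  1 - eta * (2 * gauss eta) - d <=
  K * (4 * gauss eta ^+ 2 * (1 - eta * (2 * gauss eta)) - e * B%:R^-1 + 4 * d).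
Proof.
move=> K0 KG B0 Bb e01 /andP[d0 d1] eta01 aE.
set lam := eta * (2 * gauss eta).
(* With [k >= 64 / d ^+ 2], both [4 / (k * (d / 4)) <= d / 4] and, as [sqrt (B * M) >= k], the
   Lindeberg error at [v = d / 8] is at most [d / 8]. *)
pose z := 64 / d ^+ 2.
have d2 : 0 < d ^+ 2 by rewrite exprn_gt0.
have z0 : 0 < z by rewrite divr_gt0.
pose k := (Num.truncn z).+1; pose M := (k * k)%N.
have zk : z <= k%:R by rewrite ltW// truncnS_gt.
have k0 : 0 < k%:R :> R by rewrite ltr0n.
have M0 : (0 < M)%N by rewrite muln_gt0.
have kN : k%:R <= Num.sqrt (B * M)%:R :> R.
  rewrite -[leLHS](@ger0_norm R)// -sqrtr_sqr ler_sqrt ?ler0n//.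
  by rewrite -natrX ler_nat /M -mulnn leq_pmull.
have dk : 64 <= d ^+ 2 * k%:R by move: zk; rewrite /z ler_pdivrMr// mulrC.
pose T := {ffun block_index k B M -> bool}.
pose X (i : 'I_k) (w : T) := block_sum R i w.
pose tau (b : 'I_B) (w : T) := block_flip b w.
have tauK b : involutive (tau b) by exact: block_flipK.
pose t0 : T := [ffun=> true].
have /andP[e0 e1] := e01.
have b1 : B%:R^-1 <= 1 / 1000 :> R.
  have E6 : 10 ^- 6 = 1 / 1000 * (1 / 1000) :> R by field.
  by move: Bb; rewrite E6; clear; lra.
have th0 : 0 < d / 4 by rewrite divr_gt0.
have e01' : 0 <= e <= 1 by rewrite (ltW e0)/=; move: e1 b1; clear; lra.
have [F F1 FV] := @vector_value_ge R T 'I_k ord0 t0 B X tau lam e (d / 4) B0 e01' th0 tauK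
  (fun i => avg_block_sum_sqr R i B0 M0) (fun b i => avg_block_sum_flip R i b B0 M0)
  (ltac:(rewrite card_ord; exact: avg_block_sum_norm4)).
pose A : R := 1 + e * (1 - 2 * B%:R^-1).
pose a (t s : T) : R := #|T|%:R^-1 ^+ 2 * (A * \sum_i X i t * X i s) -
      #|T|%:R^-1 * (lam * (s == t)%:R) -
      #|T|%:R^-1 * (e * B%:R^-1 * \sum_b (s == tau b t)%:R).
have kT : (k <= #|T| + #|T|)%N.
  rewrite card_ffun card_bool /block_index !card_prod !card_ord.
  apply: leq_trans (leq_addr _ _); apply: leq_trans (ltnW (ltn_expl _ (isT : (1 < 2)%N))).
  by rewrite leq_pmulr// muln_gt0 B0.
have aV (f g : T -> R) : (forall t, f t = 1 \/ f t = -1) ->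
     (forall t, g t = 1 \/ g t = -1) -> \sum_t \sum_s a t s * f t * g s <=
     4 * gauss eta ^+ 2 * (1 - lam) - e * B%:R^-1 + 4 * d.
  move=> f1 g1; rewrite kernel_formE -mulrA.
  apply: (@scalar_value_le R T 'I_k ord0 t0 B X tau f g eta e d) => //.
    by rewrite (ltW d0).
  move=> u u1; split=> [t|b]; last exact: avg_block_flip_pow4.
  have v0 : 0 < d / 8 by rewrite divr_gt0.
  apply: (le_trans (block_sum_threshold_le t B0 M0 v0 u1)).
  set N := Num.sqrt _ in kN *.
  have N0 : 0 < N by exact: lt_le_trans k0 kN.
  have : N^-1 / (d / 8) <= d / 8.
    rewrite ler_pdivrMr// -[leLHS]mul1r ler_pdivrMr//.
    have := ler_wpM2l (ltW d2) kN; move: dk; clear; lra.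
  lra.
have := grothendieck_bound_finite t0 (ltW K0) KG kT F1 aV.
apply: le_trans.
have -> : \sum_t \sum_s a t s * (\sum_i F i t * F i s) =
    A * (\sum_i \sum_l avg (fun w => F l w * X i w) ^+ 2) -
    lam * avg (fun w => \sum_i F i w ^+ 2) -
    e * (B%:R^-1 * \sum_b avg (fun w => \sum_i F i w * F i (tau b w))).
  transitivity (\sum_i \sum_t \sum_s a t s * F i t * F i s).
    rewrite [RHS]exchange_big /=; apply: eq_bigr => t _.
    rewrite [RHS]exchange_big /=; apply: eq_bigr => s _.
    by rewrite mulr_sumr; apply: eq_bigr => i _; rewrite mulrA.
  under eq_bigr do rewrite kernel_formE.
  rewrite !sumrB; congr (_ - _ - _).
  - by rewrite -mulr_sumr [X in _ = A * X]exchange_big.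
  - by rewrite -mulr_sumr avg_sum.
  - rewrite -mulr_sumr exchange_big /= mulrA; congr (_ * _); apply: eq_bigr => b _.
    by rewrite avg_sum.
apply: le_trans FV; rewrite card_ord.
have H : 8 / k%:R + d / 4 + 4 / (k%:R * (d / 4)) <= d.
  have h1 : 8 / k%:R <= d / 4.
    rewrite ler_pdivrMr//.
    have : d * (d * k%:R) <= 1 * (d * k%:R).
      by rewrite ler_wpM2r ?mulr_ge0 ?(ltW d0) ?(ltW k0)//; move: d1; clear; lra.
    by move: dk; clear; lra.
  have h2 : 4 / (k%:R * (d / 4)) <= d / 4.
    rewrite ler_pdivrMr ?mulr_gt0//.
    by move: dk; clear; lra.
  by move: h1 h2 d0; clear; lra.
by move: H; clear; lra.
Qed.

Lemma grothendieck_bound_ge (R : realType) (K eta : R) :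
  0 < K -> grothendieck_bound K -> 1 / 5 <= eta <= 3 / 10 ->
  4 * gauss eta ^+ 2 = 4 * Phi (- eta) - 1 ->
  (4 * gauss eta ^+ 2)^-1 + 10 ^- 26 <= K.
Proof.
move=> K0 KG eta01 aE.
(* Here [B = 10 ^ 6] and [e = 10 ^- 9]; the existentials keep both as variables known only through
   equations. *)
have [B [B0 BE]] : exists B : nat, (0 < B)%N /\ B%:R = 10 ^+ 6 :> R.
  by exists (10 ^ 6)%N; rewrite expn_gt0 natrX.
have [e eE] : exists e : R, e = B%:R^-1 / 10 ^+ 3 by eexists.
have b0 : 0 < B%:R^-1 :> R by rewrite invr_gt0 ltr0n.
have H d : 0 < d <= 1 / 10 -> 1 - eta * (2 * gauss eta) - d <=
  K * (4 * gauss eta ^+ 2 * (1 - eta * (2 * gauss eta)) - e * B%:R^-1 + 4 * d).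
  have b6 : B%:R^-1 <= 10 ^- 6 :> R by rewrite BE.
  have e01 : 0 < e <= B%:R^-1 / 1000.
    have -> : B%:R^-1 / 1000 = e by rewrite eE; congr (_ / _); ring.
    by rewrite lexx andbT eE divr_gt0 ?exprn_gt0.
  by move=> d01; exact: grothendieck_bound_perturbed.
have ebE : e * B%:R^-1 = 10 ^- 15.
  by rewrite eE BE -!invfM -!exprD.
have g0 := gauss_gt0 eta; have g1 := gauss_le0 eta; have /andP[_ g2] := gauss0_bounds R.
have /andP[n1 n2] := eta01.
set a := 4 * gauss eta ^+ 2 in H *; set l := eta * (2 * gauss eta) in H.
have a0 : 0 < a by rewrite mulr_gt0// exprn_gt0.
have a1 : a <= 1 by move: g0 g1 g2; rewrite /a; clear; nra.
have a2 : 1 / 2 <= a.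
  have h1 := gauss_ge eta; have /andP[h2 _] := gauss0_bounds R.
  have h5 : 955 / 1000 <= 1 - eta ^+ 2 / 2 by move: n1 n2; clear; nra.
  have h6 : 955 / 1000 * (395 / 1000) <= gauss eta by move: h1 h2 h5; clear; nra.
  by move: h6; rewrite /a; clear; nra.
have l1 : l <= 1 / 2 by move: g0 g1 g2 n1 n2; rewrite /l; clear; nra.
have l0 : 0 <= l by move: g0 n1; rewrite /l; clear; nra.
set y : R := 10 ^- 15 in ebE; set z : R := 10 ^- 26.
have y0 : 0 < y by rewrite invr_gt0 exprn_gt0.
have y1 : y <= 1 / 1000.
  have -> : 1 / 1000 = 10 ^- 3 :> R by field.
  by rewrite lef_pV2 ?posrE ?exprn_gt0// ler_weXn2l// ler1n.
have zy : z * 2 <= y.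
  have -> : z = y * 10 ^- 11 by rewrite /z /y -invfM -exprD.
  rewrite -mulrA ler_piMr ?(ltW y0)//.
  rewrite mulrC ler_pdivrMr ?exprn_gt0// mul1r exprS.
  have : 1 <= 10 ^+ 10 :> R by rewrite exprn_ege1//; lra.
  lra.
have z0 : 0 < z by rewrite invr_gt0 exprn_gt0.
(* Limit as [d] tends to 0: if this failed by [x], a [d] with [d * (1 + 4 * K) <= x / 2] would
   contradict [H]. *)
have KH : 1 - l <= K * (a * (1 - l) - y).
  rewrite leNgt; apply/negP => lt.
  set x := 1 - l - K * (a * (1 - l) - y).
  have x0 : 0 < x by rewrite subr_gt0.
  pose d := Num.min (1 / 10) (x / (2 * (1 + 4 * K))).
  have K1 : 0 < 2 * (1 + 4 * K) by move: K0; clear; lra.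
  have d0 : 0 < d by rewrite lt_min divr_gt0//= divr_gt0.
  have d1 : d <= 1 / 10 by rewrite ge_min lexx.
  have d2 : d * (2 * (1 + 4 * K)) <= x by rewrite -ler_pdivlMr// ge_min lexx orbT.
  have := H d; rewrite d0 d1 ebE => /(_ isT).
  by move: d2 x0; rewrite /x; clear; lra.
have ay : 0 < a * (1 - l) - y by move: a2 l1 y1; clear; nra.
(* The gain [z * (a * (1 - l))] is at most [z], which is below [y <= y / a]. *)
rewrite -(ler_pM2r ay); apply: le_trans KH.
have -> : (a^-1 + z) * (a * (1 - l) - y) = 1 - l + (z * (a * (1 - l)) - y / a) - z * y.
  by field; rewrite gt_eqF.
have h1 : z * (a * (1 - l)) <= z by rewrite ler_piMr ?(ltW z0)//; move: a0 a1 l0 l1; clear; nra.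
have h2 : y <= y / a by rewrite ler_pdivlMr// ler_piMr// ltW.
have h3 : 0 <= z * y by rewrite mulr_ge0// ltW.
by move: h1 h2 h3 zy z0; clear; lra.
Qed.

Theorem theorem1p1 (R : realType) :
  ((davie_reeds_constant R + 10 ^- 26)%:E <= grothendieck_constant R)%E.
Proof.
have [eta eta01 aE] := davie_reeds_threshold R.
apply: le_ereal_inf_tmp => _ [K /= [K0 KG] <-].
rewrite lee_fin; apply: le_trans (grothendieck_bound_ge K0 KG eta01 aE).
rewrite lerD2r; apply: davie_reeds_constant_le => //.
by case/andP: eta01 => *; apply/andP; split; lra.
Qed.
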